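(* For $n,m\in\mathbb{N}$ let $kr_3(n,m)$ denote the number of partitions $\lambda_1\le\lambda_2\le\cdots\le\lambda_m$ of $n$ into $m$ parts satisfying: (a) no consecutive parts are allowed (i.e. no two parts are consecutive integers $k,k+1$); (b) odd parts do not repeat; (c) for every contiguous sub-partition $\lambda_i+\lambda_{i+1}+\lambda_{i+2}$, we have $|\lambda_i-\lambda_{i+2}|\ge4$ if $\lambda_{i+1}$ is even and appears more than once; (d'') $1$, $2$ and $3$ are not allowed to appear as parts. Then $$\begin{aligned}&\sum_{m,n\ge0}kr_3(n,m)q^nt^m\\&=\sum_{\substack{m_1,m_2,m_3,\\ m,n_{12},i,j\ge0}}\frac{P(m_1,m_2,m_3,m+1;q^2)}{(q^2;q^2)_{n_{12}}(q^6;q^6)_{m_1+m_2+2m_3}(q^2;q^2)_i(q^4;q^4)_j}\\&\quad\times q^{2mn_{12}+2n_{12}^2+3i+4j+4m_1+4m_2+10m_3+2n_{12}+(2m_1+2m_2+5m_3+n_{12}+i+2j)^2}\,t^{2m_1+2m_2+5m_3+n_{12}+i+2j},\end{aligned}$$ where the $P(m_1,m_2,m_3,m+1;q)$ are the polynomials in $q$ with (evidently) nonnegative coefficients defined in the context. Moreover, the right-hand side is an evidently positive series, i.e. every summand has nonnegative coefficients as a power series in $q$ and $t$.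
   Context: A partition is a finite nondecreasing sequence of positive integers (possibly empty); its weight is the sum of its parts. $|q|<1$ (or: identities of formal power series). $(a;q)_0=1$, $(a;q)_n=(1-a)(1-aq)\cdots(1-aq^{n-1})$. The polynomials $P$. The following notions concern partitions in which each part appears at most twice. Pairs and singletons. Read the parts $\lambda_1\le\lambda_2\le\cdots$ from left to right: at the current part $\lambda_i$, if $\lambda_{i+1}$ exists and $\lambda_{i+1}-\lambda_i\in\{0,1\}$, then $[\lambda_i,\lambda_{i+1}]$ is declared a pair and one continues with $\lambda_{i+2}$; otherwise $\lambda_i$ is declared a singleton and one continues with $\lambda_{i+1}$. So each pair is a pair of repeating parts $[k,k]$ or a pair of consecutive parts $[k,k+1]$. Backward moves on pairs. A backward move on a pair replaces $[k,k+1]$ by $[k-1,k-1]$, or $[k,k]$ by $[k-2,k-1]$ (after which the parts are re-sorted and pairs are determined anew). It is possible only if all parts of the result are positive, each part of the result appears at most twice, and the pair is not moved through another pair, i.e. the smaller part of the moved pair is at least the larger part of the immediately preceding pair (if there is one). Base partitions. A base partition is a partition $\beta$ with each part appearing at most twice such that (i) no backward move is possible on any pair of $\beta$; (ii) the singletons located after the last (largest) pair (all singletons, if there are no pairs) are exactly $k+1,k+3,\dots,k+2n_{12}-1$ for some $n_{12}\ge0$, where the largest pair is $[k,k]$ or $[k,k+1]$, and $k=0$ if there are no pairs. The singletons in (ii) are called moveable; the other singletons, lying between pairs, are called immobile. Blocks. A block of a base partition is a group of five parts of the form $[k-1,k],k,[k+2,k+2]$ (two successive pairs with an immobile singleton $k$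 between them). Definition of $P$. For $m_1,m_2,m_3\in\mathbb{N}$ not all zero and $m\in\mathbb{Z}$, $P(m_1,m_2,m_3,m+1;q)=\sum_\beta q^{w(\beta)}$, the sum over base partitions $\beta$ without moveable singletons having exactly $m_3$ blocks, $m_1$ pairs of repeating parts not contained in blocks, and $m_2$ pairs of consecutive parts not contained in blocks, and whose largest pair is $[m,m]$ or $[m,m+1]$; $w(\beta)$ is the weight. Also $P(0,0,0,1;q)=1$ and $P(0,0,0,m+1;q)=0$ for $m\ne0$. $P(\cdots;q^2)$ means $q$ replaced by $q^2$. *)

(* Defs.v *)
From HB Require Import structures.
From mathcomp Require Import all_boot all_order all_algebra.
From mathcomp Require Import boolp.

Set Implicit Arguments.
Unset Strict Implicit.
Unset Printing Implicit Defensive.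

Import Order.TTheory GRing.Theory Num.Theory.
Local Open Scope ring_scope.

(** * Formal power series *)

(** The series [\sum_n (f n) X^n]; a bivariate series in [q] and [t] is an
    element of [fps (fps R)], with outer variable [t] and inner variable [q]. *)
Record fps (R : Type) := Fps { fps_coef :> nat -> R }.

Lemma fpsP (R : Type) (f g : fps R) : (forall n, f n = g n) <-> f = g.
Proof.
split=> [fg | -> //]; case: f g fg => [f] [g] /= fg.
by congr Fps; apply/funext.
Qed.

HB.instance Definition _ (R : Type) := gen_eqMixin (fps R).
HB.instance Definition _ (R : Type) := gen_choiceMixin (fps R).

Section FpsZmod.
Variable R : zmodType.
Implicit Types f g h : fps R.

Definition fps_zero : fps R := Fps (fun=> 0).
Definition fps_opp f : fps R := Fps (fun n => - f n).
Definition fps_add f g : fps R := Fps (fun n => f n + g n).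

Fact fps_addA : associative fps_add.
Proof. by move=> f g h; apply/fpsP => n /=; rewrite addrA. Qed.
Fact fps_addC : commutative fps_add.
Proof. by move=> f g; apply/fpsP => n /=; rewrite addrC. Qed.
Fact fps_add0 : left_id fps_zero fps_add.
Proof. by move=> f; apply/fpsP => n /=; rewrite add0r. Qed.
Fact fps_addN : left_inverse fps_zero fps_opp fps_add.
Proof. by move=> f; apply/fpsP => n /=; rewrite addNr. Qed.

HB.instance Definition _ :=
  GRing.isZmodule.Build (fps R) fps_addA fps_addC fps_add0 fps_addN.

End FpsZmod.

Section FpsRing.
Variable R : comNzRingType.
Implicit Types f g h : fps R.

Definition fpsC (c : R) : fps R := Fps (fun n => if n == 0%N then c else 0).
Definition fpsX : fps R := Fps (fun n => (n == 1%N)%:R).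
Definition fps_mul f g : fps R :=
  Fps (fun n => \sum_(j < n.+1) f j * g (n - j)%N).

Let trunc n f : {poly R} := \poly_(i < n.+1) f i.

Let fps_mulE f g n m : (n <= m)%N -> fps_mul f g n = (trunc m f * trunc m g)`_n.
Proof.
move=> le_nm; rewrite coefM; apply: eq_bigr => j _; rewrite !coef_poly.
by rewrite !ltnS (leq_trans (leq_ord j)) // (leq_trans (leq_subr _ _)).
Qed.

Fact fps_mulC : commutative fps_mul.
Proof. by move=> f g; apply/fpsP => n; rewrite !(@fps_mulE _ _ n n) // mulrC. Qed.

Fact fps_mulA : associative fps_mul.
Proof.
have H f g h n : fps_mul (fps_mul f g) h n = (trunc n f * trunc n g * trunc n h)`_n.
  rewrite (@fps_mulE _ _ n n) // [LHS]coefM [RHS]coefM.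
  apply: eq_bigr => j _; congr (_ * _).
  by rewrite coef_poly ltn_ord (@fps_mulE _ _ j n) // leq_ord.
move=> f g h; apply/fpsP => n.
by rewrite fps_mulC !H; congr (_`_n); rewrite mulrC mulrA.
Qed.

Fact fps_mul1 : left_id (fpsC 1) fps_mul.
Proof.
move=> f; apply/fpsP => n /=.
by rewrite big_ord_recl /= subn0 mul1r big1 ?addr0 // => j _; rewrite mul0r.
Qed.

Fact fps_mulDl : left_distributive fps_mul (@fps_add R).
Proof.
move=> f g h; apply/fpsP => n /=.
by rewrite -big_split; apply: eq_bigr => j _; rewrite /= mulrDl.
Qed.

Fact fps_one_neq0 : fpsC 1 != 0 :> fps R.
Proof. by apply/eqP => /fpsP/(_ 0%N)/eqP; rewrite /= oner_eq0. Qed.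

HB.instance Definition _ := GRing.Zmodule_isComNzRing.Build (fps R)
  fps_mulA fps_mulC fps_mul1 fps_mulDl fps_one_neq0.

Lemma coef_fpsM f g n : (f * g) n = \sum_(j < n.+1) f j * g (n - j)%N.
Proof. by []. Qed.

Lemma coef_fps1 n : (1 : fps R) n = (n == 0%N)%:R.
Proof. by rewrite /=; case: eqP. Qed.

End FpsRing.

Section FpsUnitRing.
Variable R : comUnitRingType.
Implicit Types f g h : fps R.

(** The first [n] coefficients of the inverse of [f], obtained by solving
    [\sum_(j <= k) f j * g (k - j) = (k == 0)] for [g k]. *)
Fixpoint fps_inv_seq f n : seq R :=
  if n is k.+1 then
    let s := fps_inv_seq f k in
    rcons s (((k == 0%N)%:R - \sum_(j < k) f j.+1 * s`_(k - j.+1)) / f 0%N)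
  else [::].

Definition fps_unit : pred (fps R) := fun f => f 0%N \is a GRing.unit.

Definition fps_inv f : fps R :=
  if fps_unit f then Fps (fun n => (fps_inv_seq f n.+1)`_n) else f.

Let size_inv_seq f n : size (fps_inv_seq f n) = n.
Proof. by elim: n => //= n IH; rewrite size_rcons IH. Qed.

Let nth_inv_seq f n k : (k < n)%N ->
  (fps_inv_seq f n)`_k = (fps_inv_seq f k.+1)`_k.
Proof.
elim: n => // n IH; rewrite ltnS leq_eqVlt => /orP[/eqP -> // | lt_kn].
by rewrite [in LHS]/= nth_rcons size_inv_seq lt_kn IH.
Qed.

Fact fps_mulVr : {in fps_unit, left_inverse 1 fps_inv *%R}.
Proof.
move=> f Uf; have Uf0 : f 0%N \is a GRing.unit := Uf.
rewrite mulrC; apply/fpsP => n; rewrite coef_fpsM coef_fps1 big_ord_recl /= subn0.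
rewrite /fps_inv (_ : fps_unit f) //=.
rewrite nth_rcons size_inv_seq ltnn eqxx mulrC mulrVK //.
rewrite -[RHS](subrK (\sum_(j < n) f j.+1 * (fps_inv_seq f n)`_(n - j.+1))).
congr (_ + _); apply: eq_bigr => j _; congr (_ * _).
rewrite [RHS]nth_inv_seq; first by [].
by rewrite ltn_subrL /= (leq_ltn_trans (leq0n j)).
Qed.

Fact fps_unitPl f g : g * f = 1 -> fps_unit f.
Proof.
move=> /fpsP/(_ 0%N); rewrite coef_fpsM coef_fps1 big_ord1 /= => gf1.
by apply/unitrPr; exists (g 0%N); rewrite mulrC.
Qed.

Fact fps_inv_out : {in [predC fps_unit], fps_inv =1 id}.
Proof. by move=> f; rewrite inE /fps_inv => /negbTE; rewrite /in_mem /= => ->. Qed.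

HB.instance Definition _ := GRing.ComNzRing_hasMulInverse.Build (fps R)
  fps_mulVr fps_unitPl fps_inv_out.

End FpsUnitRing.

(** Unconditional convergence of a family of bivariate series to [F], in the
    product topology: every coefficient of the finite partial sums is
    eventually constant, equal to that of [F]. *)
Definition fps2_sum (I : eqType) (R : comNzRingType)
    (f : I -> fps (fps R)) (F : fps (fps R)) : Prop :=
  forall k n : nat, exists s0 : seq I, forall s : seq I,
    uniq s -> {subset s0 <= s} -> \sum_(i <- s) f i k n = F k n.

Definition qpoch (A : comNzRingType) (a q : A) (n : nat) : A :=
  \prod_(i < n) (1 - a * q ^+ i).

(** * Partitions *)

Local Open Scope nat_scope.

Definition is_partition (s : seq nat) : bool :=
  sorted leq s && all (ltn 0) s.

Definition kr3_cond (s : seq nat) : bool :=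
  [&& all (fun x => x.+1 \notin s) s,
      all (fun x => odd x ==> (count_mem x s == 1)) s,
      [forall i : 'I_(size s - 2),
         let b := nth 0 s i.+1 in
         ~~ odd b && (1 < count_mem b s) ==>
         (4 <= `|(nth 0 s i)%:Z - (nth 0 s i.+2)%:Z|)%R]
    & all (fun x => x \notin [:: 1; 2; 3]) s].

(** The parts of a partition of [n] are at most [n]. *)
Definition kr3 (n m : nat) : nat :=
  #|[set l : m.-tuple 'I_n.+1 |
      let s := [seq val x | x <- l] in
      [&& is_partition s, sumn s == n & kr3_cond s]]|.

Definition at_most_twice (s : seq nat) : bool :=
  all (fun x => count_mem x s <= 2) s.

(** The decomposition of a partition into pairs and singletons, each group
    being given as the sequence of its one or two parts. *)
Fixpoint groups (s : seq nat) : seq (seq nat) :=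
  match s with
  | x :: ((y :: s2) as s1) =>
      if (y == x) || (y == x.+1) then [:: x; y] :: groups s2
      else [:: x] :: groups s1
  | [:: x] => [:: [:: x]]
  | [::] => [::]
  end.

Definition is_pair (g : seq nat) : bool := size g == 2.
Definition is_repeating (g : seq nat) : bool :=
  is_pair g && (last 0 g == head 0 g).
Definition is_consecutive (g : seq nat) : bool :=
  is_pair g && (last 0 g == (head 0 g).+1).

Definition pairs (s : seq nat) : seq (seq nat) :=
  [seq g <- groups s | is_pair g].

(** The smaller part of the largest pair, and 0 if there are no pairs. *)
Definition largest_pair (s : seq nat) : nat := head 0 (last [::] (pairs s)).

Definition moveable (s : seq nat) : seq nat :=
  let r := rev (groups s) in rev (flatten (take (find is_pair r) r)).

(** Truncated subtraction yields a part 0, hence an impossible move, exactly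
    when the actual move yields a nonpositive part. *)
Definition back (g : seq nat) : seq nat :=
  let a := head 0 g in
  if is_repeating g then [:: a - 2; a - 1] else [:: a - 1; a - 1].

Definition moved (s : seq nat) (i : nat) : seq nat :=
  let G := groups s in
  sort leq (flatten (set_nth [::] G i (back (nth [::] G i)))).

(** [i] is an index in [groups s]. The last condition compares the pair after
    the move with the preceding pair. *)
Definition back_possible (s : seq nat) (i : nat) : bool :=
  let G := groups s in
  let g := nth [::] G i in
  let prev := [seq h <- take i G | is_pair h] in
  [&& i < size G, is_pair g, all (ltn 0) (moved s i), at_most_twice (moved s i)
    & (prev == [::]) || (last 0 (last [::] prev) <= head 0 (back g))].

Definition base_partition (s : seq nat) : bool :=
  [&& is_partition s, at_most_twice s,
      ~~ has (back_possible s) (iota 0 (size (groups s)))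
    & moveable s ==
        mkseq (fun j => largest_pair s + j.*2.+1) (size (moveable s))].

(** The block [[k-1,k], k, [k+2,k+2]] consists of three successive groups. *)
Definition block_at (s : seq nat) (i : nat) : bool :=
  let G := groups s in
  let k := last 0 (nth [::] G i) in
  (0 < k) &&
  (take 3 (drop i G) == [:: [:: k.-1; k]; [:: k]; [:: k.+2; k.+2]]).

Definition in_block (s : seq nat) (i : nat) : bool :=
  has (fun j => block_at s j && (j <= i <= j + 2)) (iota 0 (size (groups s))).

Definition nb_blocks (s : seq nat) : nat :=
  count (block_at s) (iota 0 (size (groups s))).

Definition nb_free (p : pred (seq nat)) (s : seq nat) : nat :=
  count (fun i => p (nth [::] (groups s) i) && ~~ in_block s i)
        (iota 0 (size (groups s))).

Definition P_index (m1 m2 m3 : nat) (m : int) (s : seq nat) : bool :=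
  [&& base_partition s, moveable s == [::],
      nb_free is_repeating s == m1, nb_free is_consecutive s == m2,
      nb_blocks s == m3, pairs s != [::] & (largest_pair s)%:Z == m].

Lemma groups_ind (Q : seq nat -> Prop) :
  Q [::] -> (forall x, Q [:: x]) ->
  (forall x y s, Q s -> Q (y :: s) -> Q [:: x, y & s]) -> forall s, Q s.
Proof.
move=> Q0 Q1 Q2 s; suff [] : Q s /\ (forall x, Q (x :: s)) by [].
by elim: s => [|y s [IH1 IH2]]; split=> // x; apply: Q2.
Qed.

Lemma flatten_groups s : flatten (groups s) = s.
Proof.
elim/groups_ind: s => [//|//|x y s IH1 IH2].
by rewrite [groups _]/=; case: ifP => _; rewrite [LHS]/= ?IH1 //; congr cons.
Qed.

Lemma groups_shape s : all (fun g => (g != [::]) &&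
  (is_pair g ==> (last 0 g <= (head 0 g).+1))) (groups s).
Proof.
elim/groups_ind: s => [//|//|x y s IH1 IH2].
rewrite [groups _]/=; case: ifP => [xy|_]; last exact: IH2.
by rewrite [all _ _]/= IH1 andbT; case/orP: xy => /eqP ->.
Qed.

Lemma at_most_twice_size K s :
  at_most_twice s -> all (ltn 0) s -> all (geq K) s -> size s <= K.*2.
Proof.
elim: K s => [|K IH] s s2 s_gt0 sK.
  by case: s s_gt0 sK {s2} => //= -[|x] s.
rewrite -(count_predC (pred1 K.+1)) doubleS -addn2 addnC leq_add //.
  rewrite -size_filter; apply: IH; apply/allP => x; rewrite mem_filter => /andP[xK xs].
  - apply: leq_trans (allP s2 x xs); rewrite count_filter.
    by apply: sub_count => y /= /andP[].
  - exact: (allP s_gt0).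
  - by have := allP sK x xs; move: xK => /= /negbTE xK; rewrite leq_eqVlt xK.
have [Ks|Ks] := boolP (K.+1 \in s); first exact: (allP s2).
by rewrite (count_memPn Ks).
Qed.

Lemma P_index_bound m1 m2 m3 m s : P_index m1 m2 m3 m s ->
  size s <= `|m|.+1.*2 /\ all (gtn `|m|.+2) s.
Proof.
case/and5P=> /and4P[/andP[s_sorted s_gt0] s2 _ _] /eqP mov0 _ _.
case/and3P=> _ pairs0 /eqP <- /=.
have bound : all (geq (largest_pair s).+1) s; last first.
  by split=> //; apply: at_most_twice_size.
suff : last 0 s <= (largest_pair s).+1.
  move=> le_last; apply/allP => x xs; apply: leq_trans le_last.
  case/splitPr: xs s_sorted => p1 p2; rewrite last_cat /= => s_sorted.
  have : sorted leq (x :: p2) by apply: subseq_sorted s_sorted; [exact: leq_trans | exact: suffix_subseq].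
  move=> /(order_path_min leq_trans)/allP xp2.
  by have := mem_last x p2; rewrite inE => /predU1P[-> // | /xp2].
move: mov0 pairs0 (groups_shape s); rewrite /moveable /largest_pair /pairs.
have -> : last 0 s = last 0 (flatten (groups s)) by rewrite flatten_groups.
case/lastP: (groups s) => [//|G g]; rewrite rev_rcons /= all_rcons => mov0 _.
rewrite filter_rcons; case: ifP mov0 => /= [g_pair _ | _ mov0].
  rewrite last_rcons -cats1 flatten_cat last_cat /= cats0 => /andP[]; case: g g_pair => [|a [|b []]] //.
by case: g mov0 => // a g /(congr1 size); rewrite size_rev.
Qed.

(** [P m1 m2 m3 (m + 1)]. The summation range, namely the sequences of length
    at most [2(|m| + 1)] with entries at most [|m| + 1], contains all the
    partitions to be counted: see [P_index_bound]. *)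
Definition P (m1 m2 m3 : nat) (l : int) : {poly int} :=
  (let m := l - 1 in
   if [&& m1 == 0%N, m2 == 0%N & m3 == 0%N] then (m == 0)%:R
   else \sum_(b : (`|m|.+1.*2).-bseq 'I_(`|m|.+2)
               | P_index m1 m2 m3 m [seq val x | x <- b])
          'X^(sumn [seq val x | x <- b]))%R.

(* Main.v *)
From HB Require Import structures.
Require Import Defs.
From mathcomp Require Import all_boot all_order all_algebra ring zify.

(** Both sides are determined by a functional equation relating a series in
    [t] to its dilations [t -> t q^d].  A dilation adds [d] to every part, so
    such equations record what happens when the smallest parts are removed.

    The left-hand side.  Subtracting 1, 3, 5, ... from the successive parts
    turns a partition counted by [kr3] into a partition in which the values
    are independent: an odd value [d >= 3] (an even single part) occurs any
    number of times; an even value [e >= 2] stands either for single odd parts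
    (if [e >= 4]) or for repeated even parts, each counting twice, but not for
    both.  With [a = t q^e], a value [e >= 4] contributes
    [1/(1 - a) + 1/(1 - a^2) - 1 = (1 + a + a^2) / (1 - a^2)].  Hence, up to
    the weight [q^(k^2)] of the subtracted staircase (the map [twist]), the
    generating series is the product of
    - the sum of [t^i q^(3i) / (q^2;q^2)_i] ([even_singles]),
    - the sum of [t^(2j) q^(4j) / (q^4;q^4)_j] ([doubles]),
    - the product of the factors [1 + a + a^2], which counts partitions with
      parts at most twice, with [q^2] for [q].

    The proof does not build this bijection.  Cutting off the smallest parts
    gives a linear equation for the series of [kr3] ([kr_functional]), the
    product satisfies the same equation ([kr_eqn_twist]), and a solution is
    determined by its constant kr_term ([kr_eqn_unique]).

    The factor with the polynomials [P].  It remains to see that partitions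
    with parts at most twice are generated by base partitions, with
    [1/(q;q)_n] for the forward moves of the [n] moveable singletons and
    [1/(q^3;q^3)_N] for those of the [N] pairs.  Whether a pair can move
    backward depends only on the groups before it, and in fact only on the
    previous pair: writing R_a for [[a,a]] and C_a for [[a,a+1]], the
    partitions without moveable singletons on which no move is possible are
    exactly the sequences starting from a fictitious pair R_0 with the steps
    - R_a followed by R_(a+1), R_(a+2) or C_(a+1),
    - C_a followed by R_(a+2), C_(a+1), C_(a+2), or by the singleton [a+1] and
      R_(a+3), which is the one step that creates a block
    ([stuck_paths] and [paths_stuck]; the polynomials [P] follow in
    [P_paths]).  Removing the first pair gives a recurrence in [N] for the
    corresponding series [a_N] and [c_N], where the start is R_0 or C_0:
    this is [step_eqs].

    Partitions with parts at most twice obey another recurrence: read the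
    first group from left to right, which gives [parse_eqs] when [N] counts
    pairs.  A computation, [parse_step], shows by induction on [N] that the
    solutions of the first system satisfy the second one.  Summing over [N],
    the series [A] of all base partitions satisfies
    [A(t) = (1 + tq + t^2 q^2) A(tq)], the equation of the product
    ([total_functional]); no move is ever followed explicitly.

    For a fixed power of [t] only finitely many summands are nonzero, so the
    convergence of the multiple sum reduces to finite rearrangements:
    congruences of series modulo [t^B] ([eq_upto]).  The summands are
    nonnegative because [1/(1 - q^n)] is a geometric series. *)

Set Implicit Arguments.
Unset Strict Implicit.
Unset Printing Implicit Defensive.

Import Order.TTheory GRing.Theory Num.Theory.
Local Open Scope ring_scope.

(** * Formal power series *)

Section Fps.
Variable R : comNzRingType.
Implicit Types (c d : R) (f g h : fps R).

Lemma coef_fpsD f g k : (f + g) k = f k + g k.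
Proof. by []. Qed.

Lemma coef_fpsN f k : (- f) k = - f k.
Proof. by []. Qed.

Lemma coef_fps_sum (I : Type) (r : seq I) (P : pred I) (F : I -> fps R) k :
  (\sum_(i <- r | P i) F i) k = \sum_(i <- r | P i) F i k.
Proof. exact: (big_morph (fun f : fps R => f k) (fun f g => erefl) erefl). Qed.

Lemma fpsC_zmod : zmod_morphism (@fpsC R).
Proof. by move=> c d; apply/fpsP => -[|k] //=; rewrite subr0. Qed.

Lemma coef_fpsCM c f k : (fpsC c * f) k = c * f k.
Proof.
rewrite coef_fpsM big_ord_recl /= subn0 big1 ?addr0 // => i _.
by rewrite mul0r.
Qed.

Lemma fpsC_monoid : monoid_morphism (@fpsC R).
Proof.
split; first by [].
by move=> c d; apply/fpsP => k; rewrite coef_fpsCM /=; case: k => //= k; rewrite mulr0.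
Qed.

HB.instance Definition _ :=
  GRing.isZmodMorphism.Build R (fps R) (@fpsC R) fpsC_zmod.
HB.instance Definition _ :=
  GRing.isMonoidMorphism.Build R (fps R) (@fpsC R) fpsC_monoid.

Lemma coef0_fpsM f g : (f * g) 0%N = f 0%N * g 0%N.
Proof. by rewrite coef_fpsM big_ord1. Qed.

Lemma coef_fpsXM f k : (fpsX R * f) k = if k is k'.+1 then f k' else 0.
Proof.
rewrite coef_fpsM; case: k => [|k]; first by rewrite big_ord1 /= mul0r.
rewrite big_ord_recl /= mul0r add0r big_ord_recl /= mul1r big1 ?addr0.
  by rewrite /bump /= subn1.
by move=> i _; rewrite mul0r.
Qed.

Lemma coef_fpsXnM n f k :
  (fpsX R ^+ n * f) k = if (n <= k)%N then f (k - n)%N else 0.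
Proof.
elim: n k => [|n IH] k; first by rewrite mul1r subn0.
by rewrite exprS -mulrA coef_fpsXM; case: k => // k; rewrite IH ltnS subSS.
Qed.

Lemma coef_fpsXn n k : (fpsX R ^+ n) k = (k == n)%:R.
Proof.
rewrite -[fpsX R ^+ n]mulr1 coef_fpsXnM coef_fps1 subn_eq0 eqn_leq andbC.
by case: leqP.
Qed.

(** The substitution [f(X) -> f(c X)]. For [c = q ^+ d] it adds [d] to every
    part counted by a series in which the exponent of [X] is the number of parts. *)
Definition dilate c f : fps R := Fps (fun k => c ^+ k * f k).

Lemma coef_dilate c f k : dilate c f k = c ^+ k * f k.
Proof. by []. Qed.

Lemma dilate_zmod c : zmod_morphism (dilate c).
Proof. by move=> f g; apply/fpsP => k /=; rewrite mulrBr. Qed.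

Lemma dilate_monoid c : monoid_morphism (dilate c).
Proof.
split; first by apply/fpsP => -[|k]; rewrite /= ?mulr0 // mul1r.
move=> f g; apply/fpsP => k; rewrite /= mulr_sumr; apply: eq_bigr => i _.
rewrite -{1}(subnKC (leq_ord i)) exprD; ring.
Qed.

HB.instance Definition _ c :=
  GRing.isZmodMorphism.Build (fps R) (fps R) (dilate c) (dilate_zmod c).
HB.instance Definition _ c :=
  GRing.isMonoidMorphism.Build (fps R) (fps R) (dilate c) (dilate_monoid c).

Lemma dilateC c d : dilate c (fpsC d) = fpsC d.
Proof. by apply/fpsP => -[|k]; rewrite /= ?mul1r ?mulr0. Qed.

Lemma dilateX c : dilate c (fpsX R) = fpsC c * fpsX R.
Proof.
by apply/fpsP => k; rewrite coef_fpsCM /=; case: eqP => [->|]; rewrite ?mulr0.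
Qed.

Lemma dilate_dilate c d f : dilate c (dilate d f) = dilate (c * d) f.
Proof. by apply/fpsP => k; rewrite /= mulrA exprMn. Qed.

Lemma dilate1 f : dilate 1 f = f.
Proof. by apply/fpsP => k /=; rewrite expr1n mul1r. Qed.

Definition vanish n f := forall k, (k < n)%N -> f k = 0.

Lemma vanishD n f g : vanish n f -> vanish n g -> vanish n (f + g).
Proof. by move=> vf vg k kn; rewrite coef_fpsD vf ?vg ?addr0. Qed.

Lemma vanishM n h f : vanish n f -> vanish n (h * f).
Proof.
move=> vf k kn; rewrite coef_fpsM big1 // => i _.
by rewrite vf ?mulr0 // (leq_ltn_trans (leq_subr _ _)).
Qed.

Lemma vanish_dilate n c f : vanish n f -> vanish n (dilate c f).
Proof. by move=> vf k kn; rewrite /= vf ?mulr0. Qed.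

Lemma vanishXM n f : vanish n f -> vanish n.+1 (fpsX R * f).
Proof. by move=> vf [|k] kn; rewrite coef_fpsXM // vf. Qed.

Lemma vanish_eq0 f : (forall n, vanish n f -> f n = 0) -> f = 0.
Proof.
move=> vf; apply/fpsP => n; suff: vanish n.+1 f by move/(_ n (leqnn _)).
elim: n => [|n IH] k; first by case: k => // _; apply: vf.
by rewrite ltnS leq_eqVlt => /predU1P[->|/IH//]; apply: vf.
Qed.

(** The right-hand side involves only coefficients of [f] of smaller index, so
    an equation of this form has no nonzero solution. *)
Lemma dilate_contraction c h f : f = fpsX R * (h * dilate c f) -> f = 0.
Proof.
move=> fE; apply: vanish_eq0 => n vf; rewrite fE.
by apply: (vanishXM (n := n)) => //; apply/vanishM/vanish_dilate.
Qed.

End Fps.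

Lemma big_uniq1 (V : nmodType) (I : eqType) (r : seq I) (x : I) (F : I -> V) :
  uniq r -> x \in r -> (forall i, i != x -> F i = 0) -> \sum_(i <- r) F i = F x.
Proof.
by move=> r_uniq xr F0; rewrite (bigD1_seq x) //= big1 ?addr0.
Qed.

Lemma big_superset (V : nmodType) (I : eqType) (s0 s : seq I) (F : I -> V) :
  uniq s0 -> uniq s -> {subset s0 <= s} -> (forall x, x \notin s0 -> F x = 0) ->
  \sum_(x <- s) F x = \sum_(x <- s0) F x.
Proof.
move=> s0_uniq s_uniq sub F0; rewrite (bigID (mem s0)) /= [X in _ + X]big1 // addr0.
rewrite -big_filter; apply/perm_big/uniq_perm; rewrite ?filter_uniq // => x.
by rewrite mem_filter; apply/andP/idP => [[]|xs0] //; split=> //; apply: sub.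
Qed.

Section Congruence.
Variable R : comNzRingType.
Implicit Types f g : fps R.

(** Congruence modulo [X ^ n]. *)
Definition eq_upto n f g := forall k, (k < n)%N -> f k = g k.

Lemma eq_uptoP n f g : eq_upto n f g <-> vanish n (f - g).
Proof.
split=> fg k kn; first by rewrite coef_fpsD coef_fpsN fg ?subrr.
by apply/eqP; rewrite -subr_eq0 -coef_fpsN -coef_fpsD fg.
Qed.

Lemma eq_upto_trans n f g h : eq_upto n f g -> eq_upto n g h -> eq_upto n f h.
Proof. by move=> fg gh k kn; rewrite fg ?gh. Qed.

Lemma eq_upto_refl n f : eq_upto n f f.
Proof. by []. Qed.

Lemma eq_uptoM n f f' g g' :
  eq_upto n f f' -> eq_upto n g g' -> eq_upto n (f * g) (f' * g').
Proof.
move=> ff' gg' k kn; rewrite !coef_fpsM; apply: eq_bigr => i _.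
rewrite ff' ?gg' //; first exact: leq_ltn_trans (leq_subr _ _) kn.
exact: leq_ltn_trans (leq_ord i) kn.
Qed.

Lemma eq_upto_sum n (I : eqType) (r : seq I) (P : pred I) (F G : I -> fps R) :
  (forall i, i \in r -> P i -> eq_upto n (F i) (G i)) ->
  eq_upto n (\sum_(i <- r | P i) F i) (\sum_(i <- r | P i) G i).
Proof.
move=> FG k kn; rewrite !coef_fps_sum big_seq_cond [RHS]big_seq_cond.
by apply: eq_bigr => i /andP[ir Pi]; apply: FG.
Qed.

Lemma eq_upto_expand n f :
  eq_upto n f (\sum_(i <- iota 0 n) fpsC (f i) * fpsX R ^+ i).
Proof.
move=> k kn; rewrite coef_fps_sum (@big_uniq1 _ _ _ k) ?iota_uniq ?mem_iota //.
  by rewrite coef_fpsCM coef_fpsXn eqxx mulr1.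
by move=> i ik; rewrite coef_fpsCM coef_fpsXn eq_sym (negbTE ik) mulr0.
Qed.

End Congruence.

(** * A q-difference system and its solution *)

Section Recurrence.
Variables (R : comUnitRingType) (Q : R).
Local Notation q := (fpsC Q).
Local Notation T := (fpsX R).
Local Notation D n := (dilate (Q ^+ n)).
Implicit Types f g : fps R.

Let addE : ((1 + 1 = 2)%N * (1 + 2 = 3)%N * (1 + 3 = 4)%N
  * (2 + 1 = 3)%N * (2 + 2 = 4)%N * (2 + 3 = 5)%N
  * (3 + 1 = 4)%N * (3 + 2 = 5)%N * (3 + 3 = 6)%N)%type.
Proof. by []. Qed.

Let fpsCXn n : fpsC (Q ^+ n) = q ^+ n.
Proof. exact: rmorphXn. Qed.

Let dilateE := (@dilateX R, @dilateC R, @dilate_dilate R, =^~ @exprD R, addE, fpsCXn).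
Let morphE := (@rmorphD, @rmorphB, @rmorphN, @rmorphM, @rmorph1, @rmorphXn).

(** The effect of removing the first pair from a sequence of [N] pairs, with
    one summand for each pair that may come first. [f] and [g] are the series of
    the sequences that may follow [[0,0]] and [[0,1]], and [f'], [g'] those with
    one pair less; the factor [1 - q ^ (3N)] comes from the normalisation by
    [1 / (q ^ 3; q ^ 3)_N]. The last summand for [g] is a singleton 1 followed by
    [[3,3]]. *)
Definition step_eqs (N : nat) f g f' g' :=
  (1 - q ^+ (3 * N)) * f = T ^+ 2 * q ^+ 2 * D 1 f' + T ^+ 2 * q ^+ 4 * D 2 f'
                           + T ^+ 2 * q ^+ 3 * D 1 g'
  /\ (1 - q ^+ (3 * N)) * g = T ^+ 2 * q ^+ 4 * D 2 f' + T ^+ 2 * q ^+ 3 * D 1 g'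
                           + T ^+ 2 * q ^+ 5 * D 2 g' + T ^+ 3 * q ^+ 7 * D 3 f'.

(** The effect of removing the first group from an arbitrary partition with
    parts at most twice: the parts equal to 1 are absent, form a singleton, or
    belong to a pair [[1,1]] or [[1,2]]. For [g] the part 1 may occur only once,
    which excludes the pair [[1,1]]. *)
Definition parse_eqs f g f' g' :=
  f = D 1 f + T * q * D 2 f + T ^+ 2 * q ^+ 2 * D 1 f' + T ^+ 2 * q ^+ 3 * D 1 g'
  /\ f - g = T ^+ 2 * q ^+ 2 * D 1 f'.

(** The second system is inherited from [N - 1] to [N] by the solutions of the
    first one. After multiplication by the unit [1 - q ^ (3N)], each new equation
    is a linear combination of the given ones and of their dilations. *)
Lemma parse_step N f g f' g' f'' g'' :
  1 - Q ^+ (3 * N.+1) \is a GRing.unit ->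
  step_eqs N.+1 f g f' g' -> step_eqs N f' g' f'' g'' ->
  parse_eqs f' g' f'' g'' -> parse_eqs f g f' g'.
Proof.
move=> Uu [H1 H2] [H3 H4] [P1 P2].
have Uq : 1 - q ^+ (3 * N.+1) \is a GRing.unit.
  by rewrite -(rmorphXn (@fpsC R)) -(rmorph1 (@fpsC R)) -rmorphB rmorph_unit.
have sub_eq0 (x y : fps R) : x = y -> x - y = 0 by move->; rewrite subrr.
have e1 := sub_eq0 _ _ H1; have e2 := sub_eq0 _ _ H2.
have dil n (x y : fps R) : x = y -> D n x - D n y = 0 by move->; rewrite subrr.
have d1 := dil 1%N _ _ H1; have d2 := dil 2%N _ _ H1.
have d3 := dil 1%N _ _ H3; have d4 := dil 1%N _ _ H4.
have p1 := dil 1%N _ _ P1; have p2 := dil 2%N _ _ P1.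
have r1 := dil 1%N _ _ P2; have r2 := dil 2%N _ _ P2; have r3 := dil 3%N _ _ P2.
rewrite !morphE /= !dilateE in d1 d2 d3 d4 p1 p2 r1 r2 r3.
split; apply/eqP; rewrite -subr_eq0; apply/eqP; apply: (mulrI Uq); rewrite mulr0.
  move: e1 d1 d2 d3 d4 p1 p2 r1 r2 r3; rewrite mulnS exprD; set x := q ^+ (3 * N).
  set t := T; set z := q; clearbody x t z => {Uq Uu}.
  set E1 := (X in X = 0 -> _); move=> e1.
  set D1 := (X in X = 0 -> _); move=> d1.
  set D2 := (X in X = 0 -> _); move=> d2.
  set D3 := (X in X = 0 -> _); move=> d3.
  set D4 := (X in X = 0 -> _); move=> d4.
  set X1 := (X in X = 0 -> _); move=> p1.
  set X2 := (X in X = 0 -> _); move=> p2.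
  set R1 := (X in X = 0 -> _); move=> r1.
  set R2 := (X in X = 0 -> _); move=> r2.
  set R3 := (X in X = 0 -> _); move=> r3.
  (* E1, D1 and D2 reduce [f] and its dilations to [f'] and [g']; D3 and D4
     eliminate the factor [q ^ (3N)]; what is left is reduced to 0 by R1, R2, R3,
     which express [g'] through [f'], and then by X1 and X2. *)
  transitivity (E1 - D1 - t * z * D2 - t ^+ 2 * z ^+ 5 * D3 - t ^+ 2 * z ^+ 6 * D4
     - t ^+ 2 * (- z ^+ 5 * R2 + z ^+ 6 * R1 - t * z ^+ 8 * R3
                - (z ^+ 5 + z ^+ 6) * X1 - z ^+ 6 * X2)); first last.
    by rewrite e1 d1 d2 d3 d4 p1 p2 r1 r2 r3; ring.
  rewrite /E1 /D1 /D2 /D3 /D4 /X1 /X2 /R1 /R2 /R3.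
  move: (D 1 f) (D 2 f) => f1 f2.
  move: (D 1 f') (D 2 f') (D 3 f') (D 4 f') => f'1 f'2 f'3 f'4.
  move: (D 1 g') (D 2 g') (D 3 g') => g'1 g'2 g'3.
  move: (D 2 f'') (D 3 f'') (D 4 f'') => f''2 f''3 f''4.
  move: (D 2 g'') (D 3 g'') => g''2 g''3.
  ring.
move: e1 e2 d3 p1 r2; rewrite mulnS exprD; set x := q ^+ (3 * N).
set t := T; set z := q; clearbody x t z => {Uq Uu}.
set E1 := (X in X = 0 -> _); move=> e1.
set E2 := (X in X = 0 -> _); move=> e2.
set D3 := (X in X = 0 -> _); move=> d3.
set X1 := (X in X = 0 -> _); move=> p1.
set R2 := (X in X = 0 -> _); move=> r2.
transitivity (E1 - E2 - t ^+ 2 * z ^+ 5 * D3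
     + t ^+ 2 * z ^+ 5 * (X1 + R2)); first last.
  by rewrite e1 e2 d3 p1 r2; ring.
rewrite /E1 /E2 /D3 /X1 /R2; ring.
Qed.

Variables (a c : nat -> fps R).
Hypothesis unitQ : forall N, 1 - Q ^+ N.+1 \is a GRing.unit.
Hypothesis c0 : c 0 = a 0.
Hypothesis a0 : a 0 = D 1 (a 0) + T * q * D 2 (a 0).
Hypothesis stepE : forall N, step_eqs N.+1 (a N.+1) (c N.+1) (a N) (c N).

(** The induction starts from a zero family at index [-1]. *)
Lemma parse N : parse_eqs (a N.+1) (c N.+1) (a N) (c N).
Proof.
elim: N => [|N IH].
  apply: (@parse_step 0 _ _ _ _ 0 0); [exact: unitQ|exact: stepE| |].
    by split; rewrite !raddf0 !(mulr0, addr0, expr0, subrr, mul0r).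
  by split; rewrite !raddf0 !(mulr0, addr0) // c0 subrr.
by apply: parse_step (stepE _) (stepE _) IH; rewrite mulnS; apply: unitQ.
Qed.

Lemma vanish_stage N : vanish N (a N) /\ vanish N (c N).
Proof.
elim: N => [|N [va vc]]; first by split=> k.
have Uq : 1 - q ^+ (3 * N.+1) \is a GRing.unit.
  rewrite -(rmorphXn (@fpsC R)) -(rmorph1 (@fpsC R)) -rmorphB rmorph_unit //.
  by rewrite mulnS; apply: unitQ.
have [Ha Hc] := stepE N.
split.
  rewrite -[a N.+1](mulKr Uq) Ha; apply: vanishM.
  rewrite !(exprS T) -!mulrA -!mulrDr; apply: vanishXM.
  by repeat first [assumption | apply: vanishD | apply: vanishM | apply: vanish_dilate].
rewrite -[c N.+1](mulKr Uq) Hc; apply: vanishM.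
rewrite !(exprS T) -!mulrA -!mulrDr; apply: vanishXM.
by repeat first [assumption | apply: vanishD | apply: vanishM | apply: vanish_dilate].
Qed.

(** The sum of a family whose [N]-th member is divisible by [X ^ N], so that
    the coefficient of [X ^ k] involves the members of index at most [k] only. *)
Definition total (b : nat -> fps R) : fps R :=
  Fps (fun k => \sum_(N < k.+1) b N k).

Lemma total_trunc (b : nat -> fps R) n : (forall N, vanish N (b N)) ->
  vanish n (total b - \sum_(N < n) b N).
Proof.
move=> vb k kn; rewrite coef_fpsD coef_fpsN coef_fps_sum /= -!(big_mkord xpredT (fun N => b N k)).
rewrite [X in _ - X](big_cat_nat (n := k.+1)) //= opprD addrA subrr add0r.
by rewrite big_nat big1 ?oppr0 // => N /andP[kN _]; rewrite vb.
Qed.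

Lemma parse_sum n :
  let A m := \sum_(N < m) a N in let C m := \sum_(N < m) c N in
  A n.+1 = D 1 (A n.+1) + T * q * D 2 (A n.+1)
     + T ^+ 2 * q ^+ 2 * D 1 (A n) + T ^+ 2 * q ^+ 3 * D 1 (C n)
  /\ A n.+1 - C n.+1 = T ^+ 2 * q ^+ 2 * D 1 (A n).
Proof.
elim: n => [|n [IH1 IH2]] /=.
  by rewrite !big_ord1 !big_ord0 !rmorph0 !mulr0 !addr0 c0 subrr.
have [P1 P2] := parse n.
rewrite (big_ord_recr n.+1) [\sum_(i < n.+2) c i]big_ord_recr /=.
have A1 : \sum_(N < n.+1) a N = \sum_(N < n) a N + a n by rewrite big_ord_recr.
have C1 : \sum_(N < n.+1) c N = \sum_(N < n) c N + c n by rewrite big_ord_recr.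
split; last by rewrite opprD addrACA IH2 P2 A1 -mulrDr -rmorphD.
rewrite C1 [X in T ^+ 2 * q ^+ 2 * D 1 X]A1 {1}IH1 {1}P1 !rmorphD /=.
by rewrite !mulrDr; ring.
Qed.

Lemma total_parse (A := total a) (C := total c) :
  A = D 1 A + T * q * D 2 A + T ^+ 2 * q ^+ 2 * D 1 A + T ^+ 2 * q ^+ 3 * D 1 C
  /\ A - C = T ^+ 2 * q ^+ 2 * D 1 A.
Proof.
have va N : vanish N (a N) by case: (vanish_stage N).
have vc N : vanish N (c N) by case: (vanish_stage N).
have eq_van (f g : fps R) : (forall n, vanish n (f - g)) -> f = g.
  move=> fg; apply/eqP; rewrite -subr_eq0; apply/eqP/vanish_eq0 => n _.
  exact: (fg n.+1).
split; apply: eq_van => n; have [E1 E2] := parse_sum n.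
  set An := \sum_(N < n) a N in E1 E2.
  set Cn := \sum_(N < n) c N in E1 E2.
  set Am := \sum_(N < n.+1) a N in E1 E2.
  have vA : vanish n (A - An) by apply: total_trunc.
  have vC : vanish n (C - Cn) by apply: total_trunc.
  have vAm : vanish n (A - Am) by move=> k kn; apply: (total_trunc (n := n.+1) va); apply: leqW.
  rewrite (_ : _ - _ = (A - Am) + (-1) * D 1 (A - Am) + (- T * q) * D 2 (A - Am)
     + (- T ^+ 2 * q ^+ 2) * D 1 (A - An) + (- T ^+ 2 * q ^+ 3) * D 1 (C - Cn)).
    by repeat first [assumption | apply: vanishD | apply: vanishM | apply: vanish_dilate].
  move/eqP: E1; rewrite -subr_eq0 => /eqP E1.
  rewrite -[LHS]subr0 -E1 !rmorphB /=.
  move: (D 1 A) (D 2 A) (D 1 C) (D 1 An) (D 1 Cn) (D 1 Am) (D 2 Am).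
  by move=> A1 A2 C1 An1 Cn1 Am1 Am2; ring.
set An := \sum_(N < n) a N in E2.
set Cm := \sum_(N < n.+1) c N in E2.
set Am := \sum_(N < n.+1) a N in E2.
have vA : vanish n (A - An) by apply: total_trunc.
have vC : vanish n (C - Cm) by move=> k kn; apply: (total_trunc (n := n.+1) vc); apply: leqW.
have vAm : vanish n (A - Am) by move=> k kn; apply: (total_trunc (n := n.+1) va); apply: leqW.
rewrite (_ : _ - _ = (A - Am) + (-1) * (C - Cm)
   + (- T ^+ 2 * q ^+ 2) * D 1 (A - An)).
  by repeat first [assumption | apply: vanishD | apply: vanishM | apply: vanish_dilate].
by rewrite !rmorphB /=; move/eqP: E2; rewrite subr_eq => /eqP ->; ring.
Qed.

(** Eliminating the second series leaves an equation of order two for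
    [A], which says that the defect [B] of the expected equation of order one
    satisfies [B(X) = - q X (1 - q ^ 2 X) B(q X)]. *)
Lemma total_functional :
  total a = (1 + T * q + T ^+ 2 * q ^+ 2) * D 1 (total a).
Proof.
have [E1 E2] := total_parse; set A := total a in E1 E2 *; set C := total c in E1 E2.
have CE : C = A - T ^+ 2 * q ^+ 2 * D 1 A by rewrite -E2; ring.
apply/eqP; rewrite -subr_eq0; apply/eqP.
apply: (@dilate_contraction _ (Q ^+ 1) (- q * (1 - T * q ^+ 2))).
rewrite {1}E1 CE !morphE /= !dilateE.
move: (D 1 A) (D 2 A) => A1 A2; ring.
Qed.

End Recurrence.

(** * Sequences of pairs and their generating series *)

(** The groups that may come next, after a pair [[a,a]] if [c] is false and
    [[a,a+1]] if [c] is true, up to and including the next pair, which is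
    recorded by the same encoding. *)
Definition steps (c : bool) (a : nat) : seq (seq (seq nat) * (bool * nat)) :=
  if c then
    [:: ([:: [:: a.+2; a.+2]], (false, a.+2));
        ([:: [:: a.+1; a.+2]], (true, a.+1));
        ([:: [:: a.+2; a.+3]], (true, a.+2));
        ([:: [:: a.+1]; [:: a.+3; a.+3]], (false, a.+3))]
  else
    [:: ([:: [:: a.+1; a.+1]], (false, a.+1));
        ([:: [:: a.+2; a.+2]], (false, a.+2));
        ([:: [:: a.+1; a.+2]], (true, a.+1))].

Fixpoint paths (c : bool) (a N : nat) : seq (seq (seq nat)) :=
  if N is N'.+1 then
    [seq st.1 ++ G | st <- steps c a, G <- paths st.2.1 st.2.2 N']
  else [:: [::]].

(** The default [a] is the state in which an empty sequence leaves the path. *)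
Definition last_pair (a : nat) (G : seq (seq nat)) : nat :=
  head 0%N (last [:: a] [seq g <- G | is_pair g]).

Variant step_spec (a : nat) :
    bool -> seq (seq nat) * (bool * nat) -> Prop :=
  | StepRR1 : step_spec a false ([:: [:: a.+1; a.+1]], (false, a.+1))
  | StepRR2 : step_spec a false ([:: [:: a.+2; a.+2]], (false, a.+2))
  | StepRC : step_spec a false ([:: [:: a.+1; a.+2]], (true, a.+1))
  | StepCR : step_spec a true ([:: [:: a.+2; a.+2]], (false, a.+2))
  | StepCC1 : step_spec a true ([:: [:: a.+1; a.+2]], (true, a.+1))
  | StepCC2 : step_spec a true ([:: [:: a.+2; a.+3]], (true, a.+2))
  | StepBlock :
      step_spec a true ([:: [:: a.+1]; [:: a.+3; a.+3]], (false, a.+3)).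

Lemma stepsP c a st : st \in steps c a -> step_spec a c st.
Proof.
case: c; rewrite !inE => Hst; repeat (case/orP: Hst => Hst);
  by move/eqP: Hst => ->; constructor.
Qed.

Lemma last_pair_step c a st G : st \in steps c a ->
  last_pair a (st.1 ++ G) = last_pair st.2.2 G.
Proof.
rewrite /last_pair filter_cat => /stepsP [];
  by case: [seq g <- G | is_pair g].
Qed.

Section PathSeries.
Variables (R : comUnitRingType) (Q : R).
Hypothesis unitQ : forall N, 1 - Q ^+ N.+1 \is a GRing.unit.
Local Notation q := (fpsC Q).
Local Notation T := (fpsX R).
Local Notation D n := (dilate (Q ^+ n)).

Lemma qpochS (x y : R) n : qpoch x y n.+1 = qpoch x y n * (1 - x * y ^+ n).
Proof. by rewrite /qpoch big_ord_recr. Qed.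

Lemma qpoch_unit d n : qpoch (Q ^+ d.+1) (Q ^+ d.+1) n \is a GRing.unit.
Proof.
elim: n => [|n IH]; first by rewrite /qpoch big_ord0 unitr1.
by rewrite qpochS unitrM IH -exprS -exprM mulnS addSn unitQ.
Qed.

Lemma qpochV d n : (1 - Q ^+ (d.+1 * n.+1)) / qpoch (Q ^+ d.+1) (Q ^+ d.+1) n.+1
  = (qpoch (Q ^+ d.+1) (Q ^+ d.+1) n)^-1.
Proof.
rewrite qpochS -exprS -exprM invrM ?qpoch_unit //.
  by rewrite mulrA divrr ?mul1r // mulnS addSn unitQ.
by rewrite mulnS addSn unitQ.
Qed.

(** The Rogers-Ramanujan series: it counts partitions into parts that differ
    by at least 2, that is, what the moveable singletons become under forward
    moves. *)
Definition singles : fps R := Fps (fun n => Q ^+ (n ^ 2) / qpoch Q Q n).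

(** Either no part equals 1, or one does and the others are at least 3. *)
Lemma singlesE : singles = D 1 singles + T * q * D 2 singles.
Proof.
apply/fpsP => n; rewrite coef_fpsD -mulrA coef_fpsXM.
case: n => [|n]; first by rewrite addr0 /= expr0 mul1r.
rewrite coef_fpsCM /= expr1.
apply/eqP; rewrite addrC -subr_eq -{1}[_ / _]mul1r -mulrBl mulrCA.
have := qpochV 0 n; rewrite !expr1 mul1n => ->; rewrite !mulrA; apply/eqP.
by rewrite -exprM -exprS -exprD; congr (_ ^+ _ / _); lia.
Qed.

Definition path_series (c : bool) (a N : nat) : fps R :=
  \sum_(G <- paths c a N) q ^+ sumn (flatten G) * T ^+ size (flatten G)
    * D (last_pair a G) singles.

Lemma path_series0 c a : path_series c a 0 = D a singles.
Proof. by rewrite /path_series big_seq1 !mul1r. Qed.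

Lemma path_seriesS c a N : path_series c a N.+1 =
  \sum_(st <- steps c a) q ^+ sumn (flatten st.1) * T ^+ size (flatten st.1)
     * path_series st.2.1 st.2.2 N.
Proof.
rewrite /path_series big_allpairs_dep /= big_seq [RHS]big_seq.
apply: eq_bigr => st st_in; rewrite mulr_sumr; apply: eq_bigr => G _.
rewrite (last_pair_step _ st_in) flatten_cat sumn_cat size_cat !exprD.
by rewrite !mulrA; congr (_ * _); rewrite -!mulrA; congr (_ * _); rewrite mulrCA.
Qed.

(** The steps are invariant under translation of all the parts. *)
Lemma path_series_dilate c d a N :
  path_series c (d + a) N = D d (path_series c a N).
Proof.
elim: N c a => [|N IH] c a; first by rewrite !path_series0 dilate_dilate exprD.
rewrite !path_seriesS; case: c; rewrite /= !big_cons big_nil /= -!addnS !IH;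
  rewrite !(rmorphD, rmorphM, rmorphXn, rmorph0) /= !(dilateX, dilateC);
  rewrite !(rmorphXn (@fpsC R)) !addn0 !exprD.
- move: (D d (path_series false a.+2 N)) (D d (path_series true a.+1 N))
    (D d (path_series true a.+2 N)) (D d (path_series false a.+3 N)).
  by move=> x1 x2 x3 x4; ring.
- move: (D d (path_series false a.+2 N)) (D d (path_series false a.+1 N))
    (D d (path_series true a.+1 N)).
  by move=> x1 x2 x3; ring.
Qed.

(** Division by [(q ^ 3; q ^ 3)_N] accounts for the forward moves of the [N]
    pairs, since each move adds 3 to the weight. *)
Definition stage (c : bool) (N : nat) : fps R :=
  fpsC (qpoch (Q ^+ 3) (Q ^+ 3) N)^-1 * path_series c 0 N.

Lemma stage_step N :
  step_eqs Q N.+1 (stage false N.+1) (stage true N.+1) (stage false N) (stage true N).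
Proof.
have cancel : (1 - q ^+ (3 * N.+1)) * fpsC (qpoch (Q ^+ 3) (Q ^+ 3) N.+1)^-1
    = fpsC (qpoch (Q ^+ 3) (Q ^+ 3) N)^-1.
  by rewrite -(qpochV 2 N) rmorphM rmorphB rmorph1 rmorphXn.
have shift c d : path_series c d.+1 N = D d.+1 (path_series c 0 N).
  by rewrite -path_series_dilate addn0.
rewrite /step_eqs /stage !mulrA cancel !rmorphM /= !dilateC !path_seriesS.
split; rewrite /= !big_cons big_nil /= !shift !addn0.
- move: (D 1 (path_series false 0 N)) (D 2 (path_series false 0 N))
    (D 1 (path_series true 0 N)).
  by move=> x1 x2 x3; ring.
- move: (D 2 (path_series false 0 N)) (D 1 (path_series true 0 N))
    (D 2 (path_series true 0 N)) (D 3 (path_series false 0 N)).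
  by move=> x1 x2 x3 x4; ring.
Qed.

Lemma stage_functional (A := total (stage false)) :
  A = (1 + T * q + T ^+ 2 * q ^+ 2) * D 1 A.
Proof.
apply: (@total_functional _ Q _ (stage true) unitQ).
- by rewrite /stage !path_series0.
- rewrite /stage path_series0 dilate1 {1}singlesE.
  by rewrite /qpoch big_ord0 invr1 !mul1r.
- exact: stage_step.
Qed.

End PathSeries.

(** * Base partitions *)

Section BasePartitions.
Local Open Scope nat_scope.

Lemma at_most_twiceP s : reflect (forall x : nat, count_mem x s <= 2) (at_most_twice s).
Proof.
apply: (iffP allP) => [s2 x | s2 x _]; last exact: s2.
by have [/s2|/count_memPn ->] := boolP (x \in s).
Qed.

Lemma at_most_twice_perm s1 s2 : perm_eq s1 s2 -> at_most_twice s1 = at_most_twice s2.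
Proof.
move=> s12; rewrite /at_most_twice (perm_all _ s12).
by apply: eq_all => x; rewrite (permP s12).
Qed.

Lemma pair_shape s g : is_partition s -> g \in groups s -> is_pair g ->
  exists h (b : bool), 0 < h /\ g = [:: h; b + h].
Proof.
move=> /andP[s_sorted s_gt0] gs g2; have := allP (groups_shape s) g gs.
have : subseq g s.
  case/splitPr: gs (flatten_groups s) => G1 G2 <-.
  rewrite flatten_cat /=; apply: subseq_trans (suffix_subseq _ _).
  exact: prefix_subseq.
move=> g_sub; have gS := mem_subseq g_sub.
have := subseq_sorted leq_trans g_sub s_sorted.
case: g g2 {g_sub gs} gS => [|h [|h' []]] //= _ gS; rewrite andbT => hh' /= h'h.
exists h, (h' != h); split; first by apply: (allP s_gt0); apply: gS; rewrite inE eqxx.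
by congr [:: _; _]; case: eqP => [->|/eqP ne]; rewrite ?add0n //=; lia.
Qed.

Lemma back_repeating h : back [:: h; h] = [:: h - 2; h - 1].
Proof. by rewrite /back /is_repeating /= eqxx. Qed.

Lemma back_consecutive h : back [:: h; h.+1] = [:: h - 1; h - 1].
Proof. by rewrite /back /is_repeating /= gtn_eqF. Qed.

(** The condition for a backward move of [g] when [Z] is the list of the groups
    before it. It depends on these only: the parts of the later groups are at
    least the larger part of [g], hence larger than those of the moved pair.
    If [Z] contains no pair, the last conjunct is vacuous since its left-hand
    side is then 0. *)
Definition can_move (Z : seq (seq nat)) (g : seq nat) : bool :=
  [&& is_pair g, all (ltn 0) (back g), at_most_twice (flatten Z ++ back g)
    & last 0 (last [::] [seq h <- Z | is_pair h]) <= head 0 (back g)].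

Lemma back_possibleE s G1 g G2 : is_partition s -> at_most_twice s ->
  groups s = G1 ++ g :: G2 -> back_possible s (size G1) = can_move G1 g.
Proof.
move=> s_part s2 sG; rewrite /back_possible /moved sG size_cat /=.
rewrite -[X in X < _]addn0 ltn_add2l /= nth_cat ltnn subnn /=.
rewrite take_size_cat //.
have -> x : set_nth [::] (G1 ++ g :: G2) (size G1) x = G1 ++ x :: G2.
  by elim: (G1) => //= g' G -> .
rewrite /can_move; case g2: (is_pair g) => //=.
have [h [b [h0 gE]]] : exists h (b : bool), 0 < h /\ g = [:: h; b + h].
  by apply: pair_shape s_part _ g2; rewrite sG mem_cat mem_head orbT.
have movedP : perm_eq (sort leq (flatten (G1 ++ back g :: G2)))
    (flatten G1 ++ back g ++ flatten G2) by rewrite perm_sort flatten_cat.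
case/andP: (s_part) => s_sorted s_gt0.
have sE : s = flatten G1 ++ g ++ flatten G2 by rewrite -(flatten_groups s) sG flatten_cat.
rewrite (perm_all _ movedP) (at_most_twice_perm movedP) !all_cat.
move: s_gt0; rewrite {1}sE !all_cat => /and3P[-> _ ->]; rewrite andbT /=.
congr [&& _, _ & _]; last first.
  by case: [seq h <- G1 | is_pair h] => [|g' G'] //=.
have G2_ge x : x \in flatten G2 -> b + h <= x.
  move: s_sorted; rewrite sE gE (sorted_pairwise leq_trans) !pairwise_cat.
  by case/and3P=> _ _ /and3P[/allrelP H _ _]; apply: H; rewrite !inE eqxx orbT.
have backE x : x \in back g -> x < b + h.
  rewrite gE; case: (b); rewrite ?add0n ?add1n ?back_repeating ?back_consecutive !inE.
    by case/orP=> /eqP ->; lia.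
  by case/orP=> /eqP ->; lia.
apply/at_most_twiceP/at_most_twiceP => H x.
  by apply: leq_trans (H x); rewrite !count_cat addnA leq_addr.
have := at_most_twiceP _ s2 x; rewrite {1}sE; have := H x; rewrite !count_cat.
have [/G2_ge xG2|/count_memPn ->] := boolP (x \in flatten G2); last by rewrite !addn0.
have /count_memPn -> : x \notin back g by apply/negP => /backE; lia.
lia.
Qed.

(** No backward move is possible on the pairs of [G], when the groups of [Z]
    come before them. *)
Fixpoint stuck (Z G : seq (seq nat)) : bool :=
  if G is g :: G' then ~~ can_move Z g && stuck (rcons Z g) G' else true.

Lemma stuck_cat Z G1 G2 : stuck Z (G1 ++ G2) = stuck Z G1 && stuck (Z ++ G1) G2.
Proof.
elim: G1 Z => [|g G1 IH] Z /=; first by rewrite cats0.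
by rewrite IH andbA cat_rcons.
Qed.

Lemma has_back_possible s : is_partition s -> at_most_twice s ->
  ~~ has (back_possible s) (iota 0 (size (groups s))) = stuck [::] (groups s).
Proof.
move=> s_part s2.
suff H Z G : groups s = Z ++ G ->
    ~~ has (back_possible s) (iota (size Z) (size G)) = stuck Z G by apply: (H [::]).
elim: G Z => [|g G IH] Z //= sG.
by rewrite negb_or (back_possibleE s_part s2 sG) -IH ?cat_rcons // size_rcons.
Qed.

(** What has to be remembered of the groups [Z] when their last pair is [[a,a]]
    or [[a,a+1]]; here [c + a] is the larger part of that pair. The empty list is
    encoded as a fictitious pair [[0,0]]. *)
Definition reached (c : bool) (a : nat) (Z : seq (seq nat)) : Prop :=
  [/\ all (geq (c + a)) (flatten Z),
      last 0 (last [::] [seq g <- Z | is_pair g]) = c + a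
    & 0 < c + a -> count_mem (c + a) (flatten Z) = 2 - c].

Lemma count_above c a Z x : reached c a Z -> c + a < x -> count_mem x (flatten Z) = 0.
Proof.
move=> [Z_le _ _] ax; apply/count_memPn/negP => /(allP Z_le) /=; lia.
Qed.

Lemma reached_step c a Z st : st \in steps c a -> reached c a Z ->
  reached st.2.1 st.2.2 (Z ++ st.1).
Proof.
move=> st_in reachedZ; have := count_above reachedZ; move: reachedZ => [Z_le _ _] count0.
have Z_le' b : c + a <= b -> all (geq b) (flatten Z).
  by move=> ab; apply: sub_all Z_le => x /= /leq_trans ->.
move: Z_le' count0 {Z_le}.
case: (stepsP st_in) => /= Z_le' count0;
  (split; [rewrite flatten_cat all_cat /= Z_le' //=; lia
          |by rewrite filter_cat /= last_cat
          |move=> _; rewrite flatten_cat count_cat count0 /=; lia]).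
Qed.

Lemma can_moveP Z g : can_move Z g ->
  [/\ all (ltn 0) (back g),
      forall x, count_mem x (flatten Z) + count_mem x (back g) <= 2
    & last 0 (last [::] [seq h <- Z | is_pair h]) <= head 0 (back g)].
Proof.
case/and4P=> _ pos /at_most_twiceP tw lt; split=> // x.
by rewrite -count_cat.
Qed.

(** Moving the new pair backward would make it pass through the previous one,
    or create a nonpositive part or a part that appears three times. *)
Lemma stuck_step c a Z st : st \in steps c a -> reached c a Z -> stuck Z st.1.
Proof.
move=> st_in [_ lastZ countZ]; move: lastZ countZ.
case: (stepsP st_in) => lastZ countZ; rewrite [stuck _ _]/= andbT //;
  apply/negP => /can_moveP;
  rewrite ?back_repeating ?back_consecutive => -[/= pos tw].
- by rewrite lastZ; lia.
- by move: (tw a); rewrite countZ /=; lia.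
- by move: (tw a); rewrite countZ /=; lia.
- by rewrite lastZ; lia.
- by rewrite lastZ; lia.
- by move: (tw a.+1); rewrite countZ /=; lia.
- by move: (tw a.+1); rewrite -cats1 flatten_cat !count_cat countZ /=; lia.
Qed.

Lemma pathsSP c a N G : G \in paths c a N.+1 -> exists st G',
  [/\ st \in steps c a, G' \in paths st.2.1 st.2.2 N & G = st.1 ++ G'].
Proof. by case/allpairsPdep=> [st [G' [? ? ->]]]; exists st, G'. Qed.

Lemma paths_stuck c a N Z G : G \in paths c a N -> reached c a Z -> stuck Z G.
Proof.
elim: N c a Z G => [|N IH] c a Z G; first by rewrite /= inE => /eqP ->.
case/pathsSP=> [st [G' [st_in G'_in ->]]] reachedZ.
rewrite stuck_cat (stuck_step st_in reachedZ) /=.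
exact: IH G'_in (reached_step st_in reachedZ).
Qed.

Lemma paths_size_pairs c a N G : G \in paths c a N -> count is_pair G = N.
Proof.
elim: N c a G => [|N IH] c a G; first by rewrite /= inE => /eqP ->.
case/pathsSP=> [st [G' [st_in /IH <- ->]]].
by rewrite count_cat; case: (stepsP st_in).
Qed.

Lemma paths_last c a N G : G \in paths c a N -> is_pair (last [:: 0; 0] G).
Proof.
elim: N c a G => [|N IH] c a G; first by rewrite /= inE => /eqP ->.
case/pathsSP=> [st [G' [st_in /IH + ->]]].
by rewrite last_cat; case: G' => // _; case: (stepsP st_in).
Qed.

Lemma paths_above c a N G : G \in paths c a N -> path leq (c + a) (flatten G).
Proof.
elim: N c a G => [|N IH] c a G; first by rewrite /= inE => /eqP ->.
case/pathsSP=> [st [G' [st_in /IH + ->]]].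
case: (stepsP st_in) => /=; rewrite ?add0n ?add1n; lia.
Qed.

Lemma paths_positive c a N G : G \in paths c a N -> all (leq a.+1) (flatten G).
Proof.
case: c => G_in.
  by have := order_path_min leq_trans (paths_above G_in).
elim: N a G G_in => [|N IH] a G; first by rewrite /= inE => /eqP ->.
case/pathsSP=> [st [G' [st_in /paths_above + ->]]].
move=> /(order_path_min leq_trans).
rewrite flatten_cat all_cat => H; apply/andP; split.
  by case: (stepsP st_in) => /=; rewrite ?ltnS ?leqnn ?leqnSn ?andbT //; lia.
by apply: sub_all H => x; case: (stepsP st_in) => /=; lia.
Qed.

Lemma paths_groups c a N G : G \in paths c a N -> groups (flatten G) = G.
Proof.
elim: N c a G => [|N IH] c a G; first by rewrite /= inE => /eqP ->.
case/pathsSP=> [st [G' [st_in /IH + ->]]].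
case: (stepsP st_in) => /= ->; rewrite ?eqxx ?orbT //.
by have -> : (a.+3 == a.+1) || (a.+3 == a.+2) = false by lia.
Qed.

(** After [[a,a+1]] the part [a+1] has already been used once. *)
Lemma paths_twice c a N G x : G \in paths c a N ->
  count_mem x (flatten G) + (c && (x == a.+1)) <= 2.
Proof.
elim: N c a G => [|N IH] c a G.
  by rewrite /= inE => /eqP ->; rewrite add0n; case: (_ && _).
case/pathsSP=> [st [G' [st_in G'_in ->]]].
have := IH _ _ _ G'_in.
have G'_above y : y < st.2.1 + st.2.2 -> count_mem y (flatten G') = 0.
  move=> yt; apply/count_memPn/negP.
  have /allP H := order_path_min leq_trans (paths_above G'_in).
  by move/H; rewrite leqNgt yt.
have G'_pos y : y <= st.2.2 -> count_mem y (flatten G') = 0.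
  move=> yt; apply/count_memPn/negP.
  by have /allP H := paths_positive G'_in; move/H; rewrite leqNgt ltnS yt.
move: (G'_above x) (G'_pos x).
by case: (stepsP st_in) => /=; rewrite ?(eq_sym x); lia.
Qed.

(** A pair far enough from the previous one can move, whatever singletons
    lie between them; the only obstruction is a part [a+1] appearing once in
    [[a,a+1]] and once as a singleton, which blocks the pair [[a+3,a+3]]. *)
Lemma can_move_pair c a Z xs h (b : bool) : reached c a Z ->
  all (leq a.+1) xs -> sorted (fun u v => u.+1 < v) (rcons xs h) ->
  at_most_twice (flatten Z ++ xs) ->
  a + 3 <= h + (b && ~~ c) ->
  ~~ [&& c, ~~ b, h == a.+3 & a.+1 \in xs] ->
  can_move (Z ++ [seq [:: x] | x <- xs]) [:: h; b + h].
Proof.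
move=> reachedZ xs_above xs_gap tw ha excl.
have xsE : flatten [seq [:: x] | x <- xs] = xs by elim: (xs) => //= x s ->.
have xs_lt x : x \in xs -> x.+1 < h.
  have tr : transitive (fun u v => u.+1 < v) by move=> u v w /=; lia.
  move: xs_gap; rewrite -cats1 (sorted_pairwise tr) pairwise_cat => /and3P[/allrelP H _ _].
  by move=> xin; apply: H => //; rewrite inE.
have xs_uniq : uniq xs.
  have : sorted ltn (rcons xs h) by apply: sub_sorted xs_gap => u v /ltnW.
  by move/(sorted_uniq ltn_trans ltnn); rewrite rcons_uniq => /andP[].
have count_xs x : count_mem x xs <= 1 by rewrite count_uniq_mem // leq_b1.
have count_xs0 x : h <= x.+1 -> count_mem x xs = 0.
  by move=> hx; apply/count_memPn/negP => /xs_lt; lia.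
have countZ0 := count_above reachedZ.
case: reachedZ => _ lastZ countZ.
have no_pair : [seq g <- [seq [:: x] | x <- xs] | is_pair g] = [::] by elim: (xs).
rewrite /can_move filter_cat no_pair cats0 lastZ flatten_cat xsE.
apply/and4P; split.
- by case: (b).
- case: b ha excl => /=; rewrite ?add1n ?add0n ?back_repeating ?back_consecutive /=; lia.
- apply/at_most_twiceP => x; have := at_most_twiceP _ tw x.
  rewrite !count_cat; move: (count_xs x) (count_xs0 x) (countZ0 x).
  move DZ: (count_mem x (flatten Z)) => nZ; move Dxs: (count_mem x xs) => nxs.
  move=> H1 H2 H3 H4.
  case: b ha excl => /=; rewrite ?add1n ?add0n ?back_repeating ?back_consecutive /=.
    by move=> ha _; case: eqP => E; lia.
  move=> ha excl; have [xE|x1] := eqVneq (h - 2) x; last by case: eqP; lia.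
  have [ax|xa] := ltnP (c + a) x; first by rewrite (H3 ax); case: eqP; lia.
  have cE : c by lia.
  have aE : a.+1 = x by lia.
  have /count_memPn : x \notin xs.
    by move: excl; rewrite cE (_ : h == a.+3) /= ?aE //; lia.
  rewrite Dxs => ->; move: countZ; rewrite cE (_ : true + a = x) // DZ => -> //; last by lia.
  by case: eqP; lia.
- case: b ha excl => /=; rewrite ?add1n ?add0n ?back_repeating ?back_consecutive /=; lia.
Qed.

Lemma groupsE x y s : groups [:: x, y & s] =
  if (y == x) || (y == x.+1) then [:: x; y] :: groups s else [:: x] :: groups (y :: s).
Proof. by []. Qed.

(** A singleton and the next part differ by at least 2, since otherwise they
    would form a pair. *)
Lemma split_first_pair s : sorted leq s -> is_pair (last [:: 0; 0] (groups s)) ->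
  s = [::] \/ exists xs h (b : bool) s',
    [/\ s = xs ++ [:: h, b + h & s'],
        groups s = [seq [:: x] | x <- xs] ++ [:: h; b + h] :: groups s'
      & sorted (fun u v => u.+1 < v) (rcons xs h)].
Proof.
elim/groups_ind: s => [|x|x y s _ IH]; [by left | by [] |].
move=> xys; rewrite groupsE; case: ifP => [xy _|/norP[yx yx1] last_pair].
  have yE : (y == x.+1) + x = y by case/orP: xy => /eqP ->; lia.
  by right; exists [::], x, (y == x.+1), s; rewrite yE.
have /andP[xy ys] : (x <= y) && sorted leq (y :: s) by [].
have [|//|[xs [h [b [s' [sE GE gap]]]]]] := IH ys.
  by move: last_pair; case: (groups (y :: s)).
right; exists (x :: xs), h, b, s'; rewrite GE sE; split=> //.
move: gap; case: xs sE {GE} => [|x1 xs] /= [<- _]; first by lia.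
by move=> ->; lia.
Qed.

(** Converse of [paths_stuck]: by [can_move_pair], the next pair must be one of
    those listed in [steps]. *)
Lemma stuck_paths s c a Z : reached c a Z ->
  path leq (c + a) s -> all (ltn 0) s -> at_most_twice (flatten Z ++ s) ->
  stuck Z (groups s) -> is_pair (last [:: 0; 0] (groups s)) ->
  groups s \in paths c a (count is_pair (groups s)).
Proof.
have [n] := ubnP (size s); elim: n s c a Z => // n IH s c a Z sn reachedZ.
move=> above s_gt0 tw stuckG last_pair.
have [sE|[xs [h [b [s' [sE GE gap]]]]]] :=
  split_first_pair (path_sorted above) last_pair; first by rewrite sE.
have abv x : x \in s -> a < x.
  move=> xs_; have := allP (order_path_min leq_trans above) x xs_.
  case: c reachedZ {above} => [_|reachedZ]; first by [].
  rewrite add0n leq_eqVlt => /predU1P[ax|//].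
  have a_gt0 : 0 < a by rewrite ax; apply: (allP s_gt0).
  have [_ _ /(_ a_gt0)] := reachedZ; rewrite add0n => countZ.
  have := at_most_twiceP _ tw a; rewrite count_cat countZ.
  have : 0 < count_mem a s by rewrite -has_count; apply/hasP; exists x => //=; rewrite ax.
  by lia.
have abv_h : a < h by apply: abv; rewrite sE mem_cat !inE eqxx orbT.
have abv_xs : all (leq a.+1) xs.
  by apply/allP => x xxs; apply: abv; rewrite sE mem_cat xxs.
(* If the first pair and the singletons before it form one of the steps, the
   induction hypothesis applies to the rest; otherwise the pair can move. *)
have [st_in|not_step] := boolP (([seq [:: x] | x <- xs] ++ [:: [:: h; b + h]], (b, h)) \in steps c a).
  have st_reached := reached_step st_in reachedZ.
  have -> : groups s = ([seq [:: x] | x <- xs] ++ [:: [:: h; b + h]]) ++ groups s'.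
    by rewrite GE -catA.
  have -> : count is_pair (([seq [:: x] | x <- xs] ++ [:: [:: h; b + h]]) ++ groups s')
      = (count is_pair (groups s')).+1.
    by rewrite !count_cat /= addn0; elim: (xs) => //= *; rewrite ?addn1.
  apply/allpairsPdep; exists ([seq [:: x] | x <- xs] ++ [:: [:: h; b + h]], (b, h)), (groups s').
  split=> //; apply: (IH _ _ _ _ _ st_reached).
  - by move: sn; rewrite sE size_cat /=; lia.
  - by move: above; rewrite sE cat_path /= => /and4P[].
  - by move: s_gt0; rewrite sE all_cat /= => /and4P[].
  - move: tw; rewrite sE flatten_cat flatten_cat /= -!catA.
    by have -> : flatten [seq [:: x] | x <- xs] = xs by elim: (xs) => //= x l ->.
  - by move: stuckG; rewrite GE -cat1s catA stuck_cat => /andP[].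
  - by move: last_pair; rewrite GE last_cat /=; case: (groups s').
have /negP not_free : ~~ can_move (Z ++ [seq [:: x] | x <- xs]) [:: h; b + h].
  by move: stuckG; rewrite GE stuck_cat /= => /and3P[].
have tw' : at_most_twice (flatten Z ++ xs).
  apply/at_most_twiceP => x; apply: leq_trans (at_most_twiceP _ tw x).
  by rewrite sE !count_cat addnA leq_addr.
case: xs {not_free IH last_pair stuckG} sE GE gap abv_xs not_step (not_free) tw'
    => [|x xs] sE GE gap abv_xs not_step not_free tw'.
  (* No singleton before the pair: only the distance to the previous pair counts. *)
  have [h_far|h_near] := leqP (a + 3) (h + (b && ~~ c)).
    by case: not_free; apply: can_move_pair reachedZ abv_xs gap tw' h_far _; rewrite !andbF.
  case: c not_step h_near reachedZ {above not_free} => not_step h_near reachedZ.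
    have [hE|hE] : h = a.+1 \/ h = a.+2 by lia.
      case: b not_step sE {GE h_near} => not_step sE; first by rewrite hE !inE !eqxx ?orbT in not_step.
      have [_ _ /(_ isT)] := reachedZ; rewrite add1n => countZ.
      have := at_most_twiceP _ tw a.+1.
      by rewrite count_cat countZ sE hE /= eqxx.
    by rewrite hE in not_step; case: b not_step {sE GE h_near} => /=; rewrite !inE !eqxx ?orbT.
  have [[hE bE]|hE] : h = a.+2 /\ b = false \/ h = a.+1 by case: (b) h_near => /=; [right|]; lia.
    by rewrite hE bE !inE !eqxx ?orbT in not_step.
  by rewrite hE in not_step; case: b not_step {sE GE h_near} => /=; rewrite !inE !eqxx ?orbT.
have tr : transitive (fun u v => u.+1 < v) by move=> u v w /=; lia.
move: (gap); rewrite /= (path_sortedE tr) => /andP[/allP gap_x _].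
have xh : x.+1 < h by apply: gap_x; rewrite mem_rcons mem_head.
have ax : a < x by case/andP: abv_xs.
have [/and4P[cE bE /eqP hE a_in]|excl] := boolP [&& c, ~~ b, h == a.+3 & a.+1 \in x :: xs]; last first.
  case: not_free; apply: can_move_pair reachedZ abv_xs gap tw' _ excl.
  by apply: leq_trans (leq_addr _ _); lia.
(* The exceptional case of [can_move_pair] is that of a block. *)
have xE : x = a.+1 by apply/eqP; rewrite eqn_leq ax -ltnS -ltnS -hE xh.
have xsE : xs = [::].
  case: xs gap {GE sE abv_xs not_step not_free tw' gap_x a_in} => //= y xs /andP[xy].
  rewrite (path_sortedE tr) => /andP[/allP H _].
  have : y.+1 < h by apply: H; rewrite mem_rcons mem_head.
  by lia.
move: not_step; rewrite cE (negbTE bE) hE xE xsE.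
by rewrite !inE !eqxx ?orbT.
Qed.

(** There are no moveable singletons when the last group is a pair; the default
    value [[:: 0; 0]] makes this true of the empty partition. *)
Lemma moveable_nil s : (moveable s == [::]) = is_pair (last [:: 0; 0] (groups s)).
Proof.
rewrite /moveable; have := groups_shape s.
case/lastP: (groups s) => [//|G g]; rewrite last_rcons rev_rcons all_rcons /=.
case/andP=> /andP[g0 _] _; case: (is_pair g) => //=.
by case: g g0 => // x g _; rewrite -size_eq0 size_rev.
Qed.

Lemma paths_base N G : G \in paths false 0 N -> base_partition (flatten G).
Proof.
move=> G_in; have GE := paths_groups G_in.
have /eqP mov0 : moveable (flatten G) == [::].
  by rewrite moveable_nil GE (paths_last G_in).
have s_part : is_partition (flatten G).
  rewrite /is_partition (paths_positive G_in) andbT.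
  exact: path_sorted (paths_above G_in).
have s2 : at_most_twice (flatten G).
  by apply/at_most_twiceP => x; have := paths_twice x G_in; rewrite addn0.
rewrite /base_partition s_part s2 mov0 has_back_possible // GE (paths_stuck G_in) //.
Qed.

Lemma base_paths s : base_partition s -> moveable s = [::] ->
  groups s \in paths false 0 (count is_pair (groups s)).
Proof.
case/and4P=> s_part s2 + _ /eqP; rewrite has_back_possible // moveable_nil => stuck_s last_s.
have /andP[s_sorted s_gt0] := s_part.
apply: (@stuck_paths s false 0 [::]) => //.
rewrite (path_sortedE leq_trans) s_sorted andbT; exact: sub_all s_gt0.
Qed.

Lemma paths_uniq c a N : uniq (paths c a N).
Proof.
elim: N c a => //= N IH c a; apply: allpairs_uniq_dep.
- by case: c; rewrite /= !inE !xpair_eqE !eqseq_cons; lia.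
- by move=> st _; apply: IH.
move=> _ _ /allpairsPdep[st1 [G1 [st1_in _ ->]]] /allpairsPdep[st2 [G2 [st2_in _ ->]]].
rewrite /= => E; have E1 : head [::] st1.1 = head [::] st2.1.
  have headE st G : st \in steps c a -> head [::] (st.1 ++ G) = head [::] st.1.
    by case/stepsP.
  by rewrite -(headE _ G1 st1_in) E headE.
have E2 : st1 = st2.
  move: E1; case: c st1_in st2_in {IH}; rewrite !inE;
  move=> H1 H2; repeat (case/orP: H1 => H1); repeat (case/orP: H2 => H2);
  move/eqP: H1 => ->; move/eqP: H2 => -> //= -[]; lia.
by move: E; rewrite E2 => /eqP; rewrite eqseq_cat // eqxx => /eqP ->.
Qed.

Definition block0 (G : seq (seq nat)) : bool :=
  let k := last 0 (head [::] G) in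
  (0 < k) && (take 3 G == [:: [:: k.-1; k]; [:: k]; [:: k.+2; k.+2]]).

Definition in_block_of (G : seq (seq nat)) (i : nat) : bool :=
  has (fun j => block0 (drop j G) && (j <= i <= j + 2)) (iota 0 (size G)).

Definition blocks_of (G : seq (seq nat)) : nat :=
  count (fun i => block0 (drop i G)) (iota 0 (size G)).

Definition free_of (p : pred (seq nat)) (G : seq (seq nat)) : nat :=
  count (fun i => p (nth [::] G i) && ~~ in_block_of G i) (iota 0 (size G)).

Lemma block_atE s i : block_at s i = block0 (drop i (groups s)).
Proof.
rewrite /block_at /block0 -nth0 nth_drop addn0.
by [].
Qed.

Lemma in_blockE s i : in_block s i = in_block_of (groups s) i.
Proof. by apply: eq_has => j; rewrite block_atE. Qed.

Lemma nb_blocksE s : nb_blocks s = blocks_of (groups s).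
Proof. by apply: eq_count => i; rewrite block_atE. Qed.

Lemma nb_freeE p s : nb_free p s = free_of p (groups s).
Proof. by apply: eq_count => i; rewrite in_blockE. Qed.

Lemma blocks_cons g G : blocks_of (g :: G) = block0 (g :: G) + blocks_of G.
Proof.
rewrite /blocks_of /= -[1]/(0.+1) (iotaDl 1 0) count_map /=; congr (_ + _).
Qed.

Lemma in_block0 g G : in_block_of (g :: G) 0 = block0 (g :: G).
Proof.
rewrite /in_block_of /= -[1]/(0.+1) (iotaDl 1 0) has_map andbT.
rewrite (@eq_has _ _ pred0) ?has_pred0 ?orbF // => j /=.
by rewrite andbF.
Qed.

Lemma in_blockS g G i : in_block_of (g :: G) i.+1 =
  (block0 (g :: G) && (i < 2)) || in_block_of G i.
Proof.
rewrite /in_block_of /= -[1]/(0.+1) (iotaDl 1 0) has_map; congr (_ || _).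
Qed.

Lemma free_cons p g G : ~~ block0 (g :: G) ->
  free_of p (g :: G) = p g + free_of p G.
Proof.
move=> nb; rewrite {1}/free_of /= -[1]/(0.+1) (iotaDl 1 0) count_map /=.
rewrite in_block0 nb andbT; congr (_ + _); apply: eq_count => i /=.
by rewrite in_blockS (negbTE nb).
Qed.

Lemma free_block p g1 g2 g3 G : block0 [:: g1, g2, g3 & G] ->
  ~~ block0 [:: g2, g3 & G] -> ~~ block0 (g3 :: G) ->
  free_of p [:: g1, g2, g3 & G] = free_of p G.
Proof.
move=> b1 b2 b3; rewrite {1}/free_of /= -[3]/(3 + 0) iotaDl count_map /=.
rewrite in_block0 !in_blockS b1 /= !andbF /=; apply: eq_count => i /=.
by rewrite !in_blockS (negbTE b2) (negbTE b3) andbF.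
Qed.

(** Blocks do not overlap and every singleton lies in a block: two of the pairs
    and one of the singletons belong to each block. *)
Definition well_counted (G : seq (seq nat)) : Prop :=
  free_of is_repeating G + free_of is_consecutive G + 2 * blocks_of G
    = count is_pair G
  /\ size (flatten G) = 2 * count is_pair G + blocks_of G.

Lemma well_counted_pair h (b : bool) G : ~~ block0 ([:: h; b + h] :: G) ->
  well_counted G -> well_counted ([:: h; b + h] :: G).
Proof.
move=> nb [E1 E2]; rewrite /well_counted !free_cons // blocks_cons (negbTE nb) /= E2 -E1.
rewrite /is_repeating /is_consecutive /=; case: b {nb} => /=; split; lia.
Qed.

(** A step with a singleton completes a block whose first pair is the current
    state, so that this pair has to be kept in the statement. *)
Lemma paths_well_counted c a N G : G \in paths c a N ->
  well_counted (if c then [:: a; a.+1] :: G else G).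
Proof.
elim: N c a G => [|N IH] c a G.
  rewrite /= inE => /eqP ->; case: c => //.
  apply: (@well_counted_pair a true) => //.
  by rewrite /block0 /= !eqseq_cons ?andbF.
case/pathsSP=> [st [G' [st_in /IH + ->]]].
have noR h G1 : ~~ block0 ([:: h; h] :: G1).
  rewrite /block0 /= eqseq_cons; case: h => //= h.
  by rewrite !eqseq_cons (gtn_eqF (ltnSn h)).
have noS h G1 : ~~ block0 ([:: h] :: G1) by rewrite /block0 /= !eqseq_cons !andbF.
have noC h x y G1 : ~~ block0 [:: [:: h; h.+1], [:: x; y] & G1].
  by rewrite /block0 /= !eqseq_cons !andbF.
case: (stepsP st_in) => /= wc.
- exact: (@well_counted_pair a.+1 false).
- exact: (@well_counted_pair a.+2 false).
- exact: wc.
- apply: (@well_counted_pair a true) => //; exact: (@well_counted_pair a.+2 false).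
- exact: (@well_counted_pair a true).
- exact: (@well_counted_pair a true).
have blk : block0 [:: [:: a; a.+1], [:: a.+1], [:: a.+3; a.+3] & G'].
  by rewrite /block0 /= take0 eqxx.
case: wc => E1 E2; rewrite /well_counted !free_block // !blocks_cons blk.
by rewrite (negbTE (noS _ _)) (negbTE (noR _ _)) /= E2 -E1; split; lia.
Qed.

Definition path_type (G : seq (seq nat)) : nat * nat * nat * nat :=
  (free_of is_repeating G, free_of is_consecutive G, blocks_of G, last_pair 0 G).

Lemma P_indexE m1 m2 m3 m s : (0 < m1 + m2 + 2 * m3) ->
  P_index m1 m2 m3 m%:Z s =
  (s \in [seq flatten G | G <- paths false 0 (m1 + m2 + 2 * m3)
                        & path_type G == (m1, m2, m3, m)]).
Proof.
move=> N_gt0; have lastE : largest_pair s = last_pair 0 (groups s).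
  by rewrite /largest_pair /last_pair /pairs; case: [seq g <- _ | _].
rewrite /P_index !nb_freeE nb_blocksE lastE eqz_nat.
apply/and5P/mapP => [[base /eqP mov0 r c]|[G]].
  case/and3P=> b pairs0 l; exists (groups s); last by rewrite flatten_groups.
  have G_in := base_paths base mov0; have [cnt _] := paths_well_counted G_in.
  rewrite mem_filter /path_type !xpair_eqE r c b l /=.
  by rewrite -(eqP r) -(eqP c) -(eqP b) cnt.
rewrite mem_filter /path_type !xpair_eqE => /andP[/andP[/andP[/andP[r c] b] l]] G_in ->.
have GE := paths_groups G_in; rewrite GE r c b l; split=> //.
- exact: paths_base G_in.
- by rewrite moveable_nil GE (paths_last G_in).
rewrite andbT /pairs GE -has_filter has_count (paths_size_pairs G_in) //.
Qed.

Lemma flatten_paths_uniq N (p : pred (seq (seq nat))) :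
  uniq [seq flatten G | G <- paths false 0 N & p G].
Proof.
rewrite map_inj_in_uniq ?filter_uniq ?paths_uniq // => G1 G2.
rewrite !mem_filter => /andP[_ /paths_groups G1E] /andP[_ /paths_groups G2E] E.
by rewrite -G1E E G2E.
Qed.

Lemma P_paths m1 m2 m3 m : P m1 m2 m3 (m%:Z + 1) =
  (\sum_(G <- paths false 0 (m1 + m2 + 2 * m3) | path_type G == (m1, m2, m3, m))
    'X^(sumn (flatten G)))%R.
Proof.
rewrite /P addrK absz_nat; case: ifP => [/and3P[/eqP-> /eqP-> /eqP->]|m_neq0].
  rewrite big_cons big_nil /= addr0.
  by rewrite /path_type /last_pair /= !xpair_eqE /= eqz_nat eq_sym; case: eqP.
have N_gt0 : 0 < m1 + m2 + 2 * m3 by lia.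
(* By [P_index_bound] the bounded sequences over which [P] sums represent
   every partition with this index. *)
pose f (b : (m.+1.*2).-bseq 'I_m.+2) := [seq val x | x <- b].
rewrite -[LHS](big_map f (fun s => P_index m1 m2 m3 m s) (fun s => 'X^(sumn s))%R).
rewrite -[RHS](big_filter) -(big_map flatten xpredT (fun s => 'X^(sumn s))%R).
rewrite -big_filter; apply: perm_big; apply: uniq_perm.
- rewrite filter_uniq // map_inj_uniq ?index_enum_uniq //.
  by move=> b1 b2 /(inj_map val_inj) /val_inj.
- exact: flatten_paths_uniq.
move=> s; rewrite mem_filter -P_indexE //; case s_ok: (P_index _ _ _ _ _) => //=.
have [size_s lt_s] := P_index_bound s_ok.
pose b : seq 'I_m.+2 := [seq inord x | x <- s].
have size_b : size b <= m.+1.*2 by rewrite size_map.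
apply/mapP; exists (Bseq size_b); first by rewrite mem_index_enum.
rewrite /f /= -map_comp -[LHS]map_id; apply/eq_in_map => x /(allP lt_s) /= xm.
by rewrite inordK.
Qed.

End BasePartitions.

(** * Generating series of predicates on sequences *)

Section SequenceSeries.
Local Open Scope nat_scope.

Local Notation q := (fpsX int).
Local Notation T := (fpsX (fps int)).
Local Notation D n := (dilate (q ^+ n)%R).

Fixpoint seqs (m n : nat) : seq (seq nat) :=
  if m is m'.+1 then [seq x :: s | x <- iota 0 n.+1, s <- seqs m' (n - x)]
  else if n == 0 then [:: [::]] else [::].

Lemma mem_seqs m n s : (s \in seqs m n) = (size s == m) && (sumn s == n).
Proof.
elim: m n s => [|m IH] n s; first by case: n => [|n]; case: s.
apply/allpairsPdep/idP => [[x [s' [+ + ->]]]|].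
  rewrite mem_iota IH /= eqSS => xn /andP[-> /eqP ->].
  by rewrite subnKC //; move: xn; lia.
case: s => [//|x s] /andP[sm /eqP <-]; exists x, s.
rewrite mem_iota IH -(eqSS (size s)) sm; split=> //; first by rewrite /= ltnS leq_addr.
by rewrite /= addKn.
Qed.

Lemma seqs_uniq m n : uniq (seqs m n).
Proof.
elim: m n => [|m IH] n; first by case: n.
apply: allpairs_uniq_dep; [exact: iota_uniq | by move=> x _; apply: IH |].
by move=> [x1 s1] [x2 s2] _ _ /= [-> ->].
Qed.

(** The exponent of the outer variable is the length, that of the inner one the
    sum, of the sequences satisfying [p]. *)
Definition seq_series (p : pred (seq nat)) : fps (fps int) :=
  Fps (fun m => Fps (fun n => Posz (count p (seqs m n)))).

Lemma eq_seq_series p p' : p =1 p' -> seq_series p = seq_series p'.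
Proof. by move=> pp'; apply/fpsP => m; apply/fpsP => n /=; rewrite (eq_count pp'). Qed.

Lemma seq_series_split (r p : pred (seq nat)) :
  seq_series p = (seq_series (fun s => p s && r s) + seq_series (fun s => p s && ~~ r s))%R.
Proof.
apply/fpsP => m; apply/fpsP => n /=; rewrite -PoszD; congr Posz.
by elim: (seqs m n) => //= s l ->; case: (p s); case: (r s); lia.
Qed.

(** The map [f] is a bijection between the sequences counted on both sides. *)
Lemma count_inj (f : seq nat -> seq nat) (p p' : pred (seq nat)) l l' : injective f ->
  uniq l -> uniq l' ->
  (forall s, p s -> exists s', s = f s') ->
  (forall s', p' s' && (s' \in l') = p (f s') && (f s' \in l)) ->
  count p l = count p' l'.
Proof.
move=> f_inj l_uniq l'_uniq p_im pf; rewrite -!size_filter -[RHS](size_map f).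
apply/perm_size/uniq_perm; rewrite ?filter_uniq ?(map_inj_uniq f_inj) ?filter_uniq //.
move=> s; rewrite mem_filter; apply/idP/mapP => [ps|[s' + ->]]; last first.
  by rewrite mem_filter pf.
have [s' sE] : exists s', s = f s' by apply: p_im; case/andP: ps.
by exists s'; rewrite // mem_filter pf -sE.
Qed.

Lemma seq_series_cons x (p : pred (seq nat)) : (forall y s, p (y :: s) -> y = x) -> ~~ p [::] ->
  seq_series p = (fpsC q ^+ x * T * seq_series (fun s => p (x :: s)))%R.
Proof.
move=> p_head p_nil; apply/fpsP => m; rewrite -rmorphXn -mulrA coef_fpsCM coef_fpsXM.
case: m => [|m]; apply/fpsP => n.
  rewrite mulr0 /=; case: n => //=.
  by rewrite (negbTE p_nil).
have p_cons s : p s -> exists s', s = x :: s'.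
  by case: s => [|y s]; [rewrite (negbTE p_nil) | move/p_head ->; exists s].
have cons_inj : injective (cons x) by move=> s1 s2 [].
rewrite coef_fpsXnM; case: leqP => xn; congr Posz.
  apply: (count_inj cons_inj) => //; try exact: seqs_uniq.
  by move=> s; rewrite !mem_seqs /= eqSS; congr [&& _, _ & _]; lia.
transitivity (count xpred0 ([::] : seq (seq nat))) => //.
apply: (count_inj cons_inj) => //; first exact: seqs_uniq.
by move=> s; rewrite mem_seqs /= andbC; symmetry; apply/negbTE; lia.
Qed.

Lemma seq_series_shift d (p : pred (seq nat)) : (forall s, p s -> all (leq d) s) ->
  seq_series p = D d (seq_series (fun s => p [seq d + x | x <- s])).
Proof.
move=> p_ge; apply/fpsP => m; apply/fpsP => n.
rewrite coef_dilate -exprM coef_fpsXnM.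
have f_inj : injective (map (addn d)) by apply: inj_map; apply: addnI.
have p_im s : p s -> exists s', s = [seq d + x | x <- s'].
  move=> /p_ge s_ge; exists [seq x - d | x <- s]; rewrite -map_comp -[LHS]map_id.
  by apply/eq_in_map => x /(allP s_ge) dx /=; rewrite subnKC.
have sumnD s : sumn [seq d + x | x <- s] = d * size s + sumn s.
  by elim: s => [|x s IH] /=; lia.
case: leqP => dn; congr Posz.
  apply: (count_inj f_inj) => //; try exact: seqs_uniq.
  move=> s; rewrite !mem_seqs size_map sumnD; congr (_ && _).
  by case: eqP => //= ->; lia.
transitivity (count xpred0 ([::] : seq (seq nat))) => //.
apply: (count_inj f_inj) => //; first exact: seqs_uniq.
move=> s; rewrite mem_seqs size_map sumnD /=; symmetry; apply/negbTE.
by case: (size s =P m) => [sm|]; rewrite ?andbF //= negb_and sm; lia.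
Qed.

End SequenceSeries.

(** * The partitions counted by kr3 *)

Section KrPartitions.
Local Open Scope nat_scope.

Local Notation q := (fpsX int).
Local Notation T := (fpsX (fps int)).

Definition gap_ok (x y : nat) : bool := (x.+1 < y) || ((x == y) && ~~ odd x).

(** No three equal entries satisfy it, so that a part appears at most twice. *)
Definition double_ok (x y z : nat) : bool := ((x == y) || (y == z)) ==> (x + 4 <= z).

Fixpoint kr_gaps (s : seq nat) : bool :=
  if s is x :: s1 then
    if s1 is y :: s2 then
      [&& gap_ok x y, (if s2 is z :: _ then double_ok x y z else true) & kr_gaps s1]
    else true
  else true.

Lemma kr_gaps_path x s : kr_gaps (x :: s) ->
  path (fun x y => gap_ok x y) x s.
Proof. by elim: s x => //= y s IH x /and3P[-> _ /IH]. Qed.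

Lemma gap_ok_leq x y : gap_ok x y -> x <= y.
Proof. by case/orP=> [/ltnW/ltnW //|/andP[/eqP ->]]. Qed.

Lemma kr_gaps_leq x s : kr_gaps (x :: s) -> all (leq x) s.
Proof.
move/kr_gaps_path/(sub_path gap_ok_leq); exact: order_path_min leq_trans.
Qed.

Definition kr_from (a : nat) (s : seq nat) : bool := all (leq a) s && kr_gaps s.

(** The part [a] has to remain single; the default of [head] only has to differ
    from [a]. *)
Definition kr_after (a : nat) (s : seq nat) : bool :=
  kr_gaps (a :: s) && (head a.+1 s != a).

Definition doubled (b : nat) (s : seq nat) : bool :=
  if s is [:: x, y & _] then (x == b) && (y == b) else false.

Lemma kr_from_skip a s :
  kr_from a s && ~~ (head a.+1 s == a) = kr_from a.+1 s.
Proof.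
case: s => [|x s]; rewrite /kr_from //=; first by rewrite gtn_eqF.
case K: (kr_gaps (x :: s)); last by rewrite /= in K *; rewrite K !andbF.
have := kr_gaps_leq K; rewrite /= in K *; rewrite K !andbT => xs.
apply/idP/idP => [/andP[/andP[ax _] xa]|/andP[ax /allP axs]].
  have {}ax : a < x by lia.
  by rewrite ax; apply: sub_all xs => y; apply: leq_trans.
rewrite (gtn_eqF ax) (ltnW ax) !andbT; apply: sub_all xs => y.
by apply: leq_trans; apply: ltnW.
Qed.

Lemma kr_from_double b s : ~~ odd b -> kr_from b [:: b, b & s] = kr_from (b + 4) s.
Proof.
move=> b_even; rewrite /kr_from /= leqnn /gap_ok eqxx b_even orbT /=.
case: s => [|z s] //=; rewrite /double_ok eqxx /=.
apply/idP/idP.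
  by case/and5P => /andP[_ _] z4 _ _ K; rewrite z4 K andbT (sub_all _ (kr_gaps_leq K)) // => y; apply: leq_trans.
case/andP=> /andP[z4 zs] K.
have bz : b.+1 < z by apply: leq_trans z4; rewrite -addn2 leq_add2l.
rewrite z4 K bz (ltnW (ltnW bz)) (sub_all _ zs) /=; last first.
  by move=> y; apply: leq_trans; apply: leq_addr.
by case: s zs {K} => //= w s /andP[-> _]; rewrite implybT.
Qed.

(** After a single part [a], the parts start at [a + 2], and a repeated part
    must be at least [a + 4]: this forbids to repeat the one even number [b]
    among [a + 2] and [a + 3]. *)
Lemma kr_afterE a s (b := a + 2 + odd a) :
  kr_after a s = kr_from (a + 2) s && ~~ doubled b s.
Proof.
have b_even : ~~ odd b by rewrite !oddD; case: (odd a).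
have bE : b = a + 2 \/ b = a + 3 by rewrite /b; case: (odd a); [right|left]; lia.
rewrite /kr_after /kr_from; case: s => [|y [|z s]].
- by rewrite /= gtn_eqF.
- by rewrite /= /gap_ok !andbT; case: (eqVneq y a) => ya; case: (odd a) => /=; lia.
case K: (kr_gaps [:: y, z & s]); last first.
  by rewrite [kr_gaps [:: a, y, z & s]]/= -/(kr_gaps [:: y, z & s]) K !andbF.
have := kr_gaps_leq K; have /andP[yz _] := kr_gaps_path K.
rewrite [kr_gaps [:: a, y, z & s]]/= -/(kr_gaps [:: y, z & s]) K !andbT => y_le.
have -> : all (leq (a + 2)) [:: y, z & s] = (a + 2 <= y).
  rewrite [LHS]/= andbC; case: (leqP (a + 2) y) => //= ay; rewrite ?andbF // andbT.
  by apply: sub_all y_le => x; apply: leq_trans.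
rewrite /= /gap_ok /double_ok; have [ya|y_neq] := eqVneq y a.
  by rewrite andbF ya; apply/esym/negbTE; lia.
rewrite /= andbT orbF addn2.
have [zE|zy] := eqVneq y z; last first.
  rewrite andbT; have -> : (y == b) && (z == b) = false; last by rewrite andbT.
  by apply: contra_neqF zy => /andP[/eqP -> /eqP ->].
move: yz; rewrite -zE /gap_ok ltnNge leqnSn eqxx /= => y_even.
have [yb|yb] := eqVneq y b; first by rewrite yb /=; case: bE => ->; lia.
have y2 : y != a + 2 + ~~ odd a.
  by apply/eqP => yE; move: y_even; rewrite yE !oddD; case: (odd a).
by move: yb y2; rewrite /b andbT; case: (odd a) => /=; lia.
Qed.

Lemma kr_from_cons a b s : a <= b -> kr_from a (b :: s) = kr_gaps (b :: s).
Proof.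
move=> ab; rewrite /kr_from; case K: (kr_gaps (b :: s)); last by rewrite andbF.
rewrite andbT /= ab; apply: sub_all (kr_gaps_leq K) => x; exact: leq_trans.
Qed.

Lemma doubled_series a b : ~~ odd b -> a <= b ->
  seq_series (fun s => kr_from a s && doubled b s)
  = (fpsC q ^+ (b + b) * T ^+ 2 * seq_series (kr_from (b + 4)))%R.
Proof.
move=> b_even ab; rewrite (@seq_series_cons b) //; first last.
  by move=> y [|z s] /andP[_] //= /andP[/eqP].
rewrite (@seq_series_cons b); first last.
- by rewrite /= andbF.
- by move=> y s /andP[_] /= /andP[_ /eqP].
rewrite (@eq_seq_series _ (kr_from (b + 4))); last first.
  move=> s; have -> : doubled b [:: b, b & s] = true by rewrite /= !eqxx.
  by rewrite andbT kr_from_cons // -(kr_from_cons _ (leqnn b)) kr_from_double.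
by rewrite exprD; move: (seq_series _) (fpsC q ^+ b)%R => k c; ring.
Qed.

Lemma kr_gapsP s : reflect
  ((forall i, i.+1 < size s -> gap_ok (nth 0 s i) (nth 0 s i.+1)) /\
   (forall i, i.+2 < size s -> double_ok (nth 0 s i) (nth 0 s i.+1) (nth 0 s i.+2)))
  (kr_gaps s).
Proof.
elim: s => [|x [|y s] IH]; [by constructor; split|by constructor; split|].
apply: (iffP and3P) => [[xy xyz /IH [H1 H2]]|[H1 H2]].
  split=> -[|i] /=; rewrite ?ltnS => hi //; [exact: H1 | by case: s xyz hi {IH H1 H2} | exact: H2].
split; first exact: (H1 0).
- by case: s H2 {IH H1} => // z s /(_ 0); apply.
- by apply/IH; split=> i hi; [apply: (H1 i.+1) | apply: (H2 i.+1)].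
Qed.

Lemma gap_okE x y : gap_ok x y -> x.+1 < y \/ x = y.
Proof. by case/orP=> [|/andP[/eqP]]; [left | right]. Qed.

(** Transitivity extends the condition on adjacent entries to all pairs. *)
Lemma gap_ok_trans : transitive gap_ok.
Proof.
move=> y x z; rewrite /gap_ok => /orP[xy|/andP[/eqP -> y_even]].
  by case/orP=> [yz|/andP[/eqP <- _]]; apply/orP; left=> //; lia.
by case/orP=> [->//|/andP[/eqP <- _]]; rewrite eqxx y_even orbT.
Qed.

Lemma count_nth2 (s : seq nat) i : i.+1 < size s ->
  nth 0 s i = nth 0 s i.+1 -> 1 < count_mem (nth 0 s i) s.
Proof.
move=> hi E; rewrite -[X in count _ X](cat_take_drop i) (drop_nth 0 (ltnW hi)) (drop_nth 0 hi).
by rewrite count_cat /= -E eqxx; lia.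
Qed.

Lemma dist_ge4 (x z : nat) : x <= z ->
  (4 <= `|Posz x - Posz z| :> int)%R = (x + 4 <= z).
Proof.
by move=> xz; rewrite distrC ger0_norm ?subr_ge0 ?lez_nat // lerBrDr lez_nat addnC.
Qed.

Lemma kr3_condE s : is_partition s && kr3_cond s = kr_from 4 s.
Proof.
apply/idP/idP => [/andP[/andP[s_sorted s_gt0] /and4P[/allP no_consec /allP odd_once]]|].
  move=> /forallP triple /allP no123.
  have nth_leq i : i.+1 < size s -> nth 0 s i <= nth 0 s i.+1.
    by move=> hi; apply: (sortedP 0 s_sorted).
  have gaps i : i.+1 < size s -> gap_ok (nth 0 s i) (nth 0 s i.+1).
    move=> hi; have := nth_leq i hi; rewrite leq_eqVlt => /predU1P[xy|].
      rewrite /gap_ok -xy ltnNge leqnSn eqxx /=.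
      apply: contraT; rewrite negbK => x_odd.
      have := odd_once _ (mem_nth 0 (ltnW hi)); rewrite x_odd /=.
      by have := count_nth2 hi xy; case: (count_mem _ _) => [|[]].
    rewrite leq_eqVlt => /predU1P[xy|]; last by rewrite /gap_ok => ->.
    by have := no_consec _ (mem_nth 0 (ltnW hi)); rewrite xy mem_nth.
  apply/andP; split.
    apply/allP => x xs; have := no123 x xs; have := allP s_gt0 x xs.
    by case: x {xs} => [|[|[|[|x]]]].
  apply/kr_gapsP; split=> // i hi.
  have hi' : i < size s - 2 by lia.
  have := triple (Ordinal hi'); rewrite /= /double_ok => /implyP H.
  apply/implyP => xyz.
  have cnt : 1 < count_mem (nth 0 s i.+1) s.
    case/orP: xyz => /eqP E; last exact: count_nth2.
    by rewrite -E; apply: count_nth2 => //; apply: ltnW.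
  have even_y : ~~ odd (nth 0 s i.+1).
    apply/negP => y_odd; have := odd_once _ (mem_nth 0 (ltnW hi)).
    by rewrite y_odd /= => /eqP E; rewrite E in cnt.
  have := H _; rewrite cnt even_y => /(_ isT).
  rewrite dist_ge4 //.
  exact: leq_trans (nth_leq i (ltnW hi)) (nth_leq i.+1 hi).
case/andP=> s_ge4 K; have [H1 H2] := kr_gapsP _ K.
have pw : pairwise gap_ok s.
  rewrite -(sorted_pairwise gap_ok_trans).
  by case: (s) K => // x s' /kr_gaps_path.
have s_sorted : sorted leq s.
  rewrite (sorted_pairwise leq_trans); apply: sub_pairwise pw => x y; exact: gap_ok_leq.
rewrite /is_partition s_sorted (sub_all _ s_ge4) /=; last by move=> x; apply: leq_trans.
have nth_lt i j : i < j -> j < size s -> gap_ok (nth 0 s i) (nth 0 s j).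
  move=> ij js; have /(pairwiseP 0) := pw; apply=> //; rewrite inE //; exact: ltn_trans js.
apply/and4P; split.
- apply/allP => x /(nthP 0)[i hi <-]; apply/negP => /(nthP 0)[j hj E].
  have {}E : nth 0 s j = (nth 0 s i).+1 := E.
  have [ij|ji|ij] := ltngtP i j.
  + by have /gap_okE := nth_lt i j ij hj; rewrite E; lia.
  + by have /gap_okE := nth_lt j i ji hi; rewrite E; lia.
  + by move: E; rewrite ij; lia.
- apply/allP => x xs; apply/implyP => x_odd.
  have nogap : gap_ok x x = false by rewrite /gap_ok x_odd andbF ltnNge leqnSn.
  case/splitPr: xs pw => p1 p2; rewrite pairwise_cat /= => /and3P[/allrelP A1 _ /andP[/allP A2 _]].
  rewrite count_cat /= eqxx (count_memPn _) ?(count_memPn _) //.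
    by apply/negP => /A2; rewrite nogap.
  by apply/negP => xp1; have := A1 x x xp1 (mem_head _ _); rewrite nogap.
- apply/forallP => -[i hi] /=; apply/implyP => /andP[y_even cnt].
  have hi2 : i.+2 < size s by lia.
  have := H2 i hi2; rewrite /double_ok.
  have [_ /= xz|] := boolP ((nth 0 s i == nth 0 s i.+1) || (nth 0 s i.+1 == nth 0 s i.+2)).
    by rewrite dist_ge4 //; apply: leq_trans xz; apply: leq_addr.
  case/norP=> xy yz.
  move=> _; have x_lt : nth 0 s i < nth 0 s i.+1.
    by rewrite ltn_neqAle xy; move/(sortedP 0): s_sorted; apply; apply: ltnW.
  have z_lt : nth 0 s i.+1 < nth 0 s i.+2.
    by rewrite ltn_neqAle yz; move/(sortedP 0): s_sorted; apply.
  have nth_mono : {in gtn (size s) &, {homo nth 0 s : i j / i <= j}}.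
    by move=> k l ks ls kl; apply: sorted_leq_nth => //; exact: leq_trans.
  suff : count_mem (nth 0 s i.+1) s = 1 by move=> c1; rewrite c1 in cnt.
  rewrite -[X in count _ X](cat_take_drop i.+1) (drop_nth 0 (ltnW hi2)) count_cat /= eqxx.
  rewrite (count_memPn _) ?(count_memPn _) //.
    apply/negP => /(nthP 0)[k]; rewrite size_drop nth_drop => ks E.
    have : nth 0 s i.+2 <= nth 0 s (i.+2 + k).
      by apply: nth_mono; rewrite ?leq_addr //; apply: (_ : _ < _); rewrite -ltn_subRL.
    by rewrite E; lia.
  apply/negP => /(nthP 0)[k]; rewrite size_take (ltnW hi2) => ks; rewrite nth_take // => E.
  have : nth 0 s k <= nth 0 s i.
    by apply: nth_mono => //; apply: (_ : _ < _); lia.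
  by rewrite E; lia.
- by apply/allP => x /(allP s_ge4); case: x => [|[|[|[|x]]]].
Qed.

Lemma kr3_series n m : Posz (kr3 n m) = seq_series (kr_from 4) m n.
Proof.
congr Posz; rewrite /kr3 cardE -(size_map (fun l : m.-tuple 'I_n.+1 => [seq val x | x <- l])).
rewrite -size_filter; apply/perm_size/uniq_perm.
- rewrite map_inj_uniq ?enum_uniq // => l1 l2.
  by move=> /(inj_map val_inj)/val_inj.
- by rewrite filter_uniq ?seqs_uniq.
move=> s; rewrite mem_filter mem_seqs; apply/mapP/idP => [[l + ->]|].
  rewrite mem_enum inE => /and3P[part sum cond].
  by rewrite -kr3_condE part cond size_map size_tuple eqxx.
rewrite -kr3_condE => /and3P[/andP[part cond] sm sum].
have lt_s x : x \in s -> x < n.+1.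
  move=> xs; rewrite ltnS -(eqP sum); case/splitPr: xs => p1 p2.
  by rewrite sumn_cat /=; lia.
have size_l : size [seq inord x : 'I_n.+1 | x <- s] == m by rewrite size_map.
have lE : [seq val x | x <- Tuple size_l] = s.
  rewrite /= -map_comp -[RHS]map_id; apply/eq_in_map => x /lt_s xn /=.
  by rewrite inordK.
exists (Tuple size_l); last by rewrite lE.
by rewrite mem_enum inE lE part sum cond.
Qed.

End KrPartitions.

(** * The functional equation of kr3 *)

Section KrSeries.
Local Notation q := (fpsX int).
Local Notation T := (fpsX (fps int)).
Local Notation D n := (dilate (q ^+ n)%R).
Local Notation K a := (seq_series (kr_from a)).
Local Notation S a := (seq_series (kr_after a)).

(** The part [a] is absent, appears once, or, if it is even, appears twice. *)
Lemma kr_from_series a : K a = K a.+1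
  + fpsC q ^+ a * T * (S a + if odd a then 0 else fpsC q ^+ a * T * K (a + 4)).
Proof.
rewrite (seq_series_split (fun s => head a.+1 s == a)) [LHS]addrC; congr (_ + _).
  exact/eq_seq_series/kr_from_skip.
rewrite (@seq_series_cons a); first last.
- by rewrite /= gtn_eqF.
- by move=> y s /andP[_ /eqP].
congr (_ * _); rewrite (seq_series_split (fun s => head a.+1 s == a)) addrC; congr (_ + _).
  by apply: eq_seq_series => s; rewrite kr_from_cons // eqxx andbT.
case: ifP => a_odd.
  rewrite (@eq_seq_series _ xpred0); last first.
    move=> s; apply/negP => /andP[]; rewrite kr_from_cons //.
    case: s => [|x s] /=; first by move=> _; rewrite gtn_eqF.
    by move=> + /eqP xa; rewrite xa /gap_ok ltnNge leqnSn a_odd andbF.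
  by apply/fpsP => m; apply/fpsP => n /=; rewrite count_pred0.
rewrite (@seq_series_cons a); first last.
- by rewrite andbC /= gtn_eqF.
- by move=> y s /andP[_ /eqP].
congr (_ * _); apply: eq_seq_series => s; rewrite !eqxx !andbT.
by rewrite -kr_from_double ?a_odd.
Qed.

Lemma kr_after_series a (b := (a + 2 + odd a)%N) :
  K (a + 2)%N = S a + fpsC q ^+ (b + b) * T ^+ 2 * K (b + 4)%N.
Proof.
have b_even : ~~ odd b by rewrite !oddD; case: (odd a).
rewrite (seq_series_split (doubled b)) addrC; congr (_ + _).
  by apply: eq_seq_series => s; rewrite kr_afterE.
by rewrite doubled_series // leq_addr.
Qed.

Lemma kr_gaps_shift d s : ~~ odd d -> kr_gaps [seq (d + x)%N | x <- s] = kr_gaps s.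
Proof.
move=> d_even; elim: s => [|x [|y s] IH] //.
rewrite ![[seq _ | _ <- _]]/= in IH *.
rewrite [LHS]/= -/(kr_gaps [:: (d + y)%N & [seq (d + x)%N | x <- s]]) IH.
rewrite [RHS]/= -/(kr_gaps (y :: s)); congr [&& _, _ & _].
  by rewrite /gap_ok oddD (negbTE d_even) eqn_add2l -addnS ltn_add2l.
by case: s {IH} => //= z s; rewrite /double_ok !eqn_add2l -addnA leq_add2l.
Qed.

Lemma kr_from_dilate a d : ~~ odd d -> K (d + a)%N = D d (K a).
Proof.
move=> d_even; rewrite (@seq_series_shift d); last first.
  by move=> s /andP[+ _]; apply: sub_all => x; apply: leq_trans; apply: leq_addr.
congr (dilate _ _); apply: eq_seq_series => s; rewrite /kr_from kr_gaps_shift // all_map.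
by congr (_ && _); apply: eq_all => x; rewrite /= leq_add2l.
Qed.

Lemma kr_after_dilate a d : ~~ odd d -> S (d + a)%N = D d (S a).
Proof.
move=> d_even; rewrite (@seq_series_shift d); last first.
  move=> s; rewrite kr_afterE => /andP[/andP[+ _] _].
  by apply: sub_all => x; apply: leq_trans; rewrite -addnA leq_addr.
congr (dilate _ _); apply: eq_seq_series => s.
rewrite /kr_after -(kr_gaps_shift (a :: s) d_even); congr (_ && _).
by case: s => [|x s]; rewrite /= -?addnS eqn_add2l.
Qed.

(** After a 5, a partition beginning with 8, 8 is forbidden while one beginning
    with 7, 9 is allowed; both pairs have sum 16. Trading one for the other makes
    the series the one of the partitions that start with at least 8, or with a 7
    followed by at least 10. The proof iterates this exchange. *)
Lemma kr_after5 : S 5 = K 8 + fpsC q ^+ 7 * T * K 10.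
Proof.
have E1 : K 7 = S 5 + fpsC q ^+ 16 * T ^+ 2 * K 12 := kr_after_series 5.
have E2 : K 7 = K 8 + fpsC q ^+ 7 * T * (S 7 + 0) := kr_from_series 7.
have S7 : S 7 = D 2 (S 5) by exact: (@kr_after_dilate 5 2).
have K10 : K 10 = D 2 (K 8) by exact: (@kr_from_dilate 8 2).
have K12 : K 12 = D 2 (K 10) by exact: (@kr_from_dilate 10 2).
apply/eqP; rewrite -subr_eq0; apply/eqP.
(* The defect [F] of the identity satisfies [F = q^7 t F(q^2 t)]. *)
apply: (@dilate_contraction _ (q ^+ 2) (fpsC q ^+ 7)).
rewrite rmorphB rmorphD 2!rmorphM rmorphXn /= dilateX dilateC -S7 -K10 -K12.
rewrite (rmorphXn (@fpsC _)) /=.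
have -> : S 5 = K 7 - fpsC q ^+ 16 * T ^+ 2 * K 12 by rewrite E1 addrK.
rewrite E2; move: (K 12) (K 10) (K 8) (S 7) => k12 k10 k8 s7.
move: (fpsC q) T => z t; ring.
Qed.

(** The terms with a minus sign remove the smallest part 4, once or twice, and
    the cubic term corrects for 4, 6, 6, where the repeated part is too close. *)
Lemma kr_functional :
  K 4 - fpsC q ^+ 4 * T * D 2 (K 4) - fpsC q ^+ 8 * T ^+ 2 * D 4 (K 4)
    + fpsC q ^+ 16 * T ^+ 3 * D 6 (K 4)
  = D 2 (K 4) + fpsC q ^+ 5 * T * D 4 (K 4)
    + fpsC q ^+ 12 * T ^+ 2 * D 6 (K 4).
Proof.
have E4 : K 4 = K 5 + fpsC q ^+ 4 * T * (S 4 + fpsC q ^+ 4 * T * K 8).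
  exact: kr_from_series 4.
have E5 : K 5 = K 6 + fpsC q ^+ 5 * T * (S 5 + 0) := kr_from_series 5.
have E6 : K 6 = S 4 + fpsC q ^+ 12 * T ^+ 2 * K 10 := kr_after_series 4.
have K6 : K 6 = D 2 (K 4) by exact: (@kr_from_dilate 4 2).
have K8 : K 8 = D 4 (K 4) by exact: (@kr_from_dilate 4 4).
have K10 : K 10 = D 6 (K 4) by exact: (@kr_from_dilate 4 6).
rewrite -K6 -K8 -K10 E4 E5 kr_after5.
have -> : S 4 = K 6 - fpsC q ^+ 12 * T ^+ 2 * K 10 by rewrite E6 addrK.
move: (K 6) (K 8) (K 10) => k6 k8 k10.
move: (fpsC q) T => z t.
ring.
Qed.

End KrSeries.

(** * The product side *)

Section ProductSide.
Local Notation q := (fpsX int).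
Local Notation Q := (fpsX int ^+ 2).
Local Notation T := (fpsX (fps int)).
Local Notation D n := (dilate (q ^+ n)%R).

Lemma unit_1subXn n : 1 - q ^+ n.+1 \is a GRing.unit.
Proof.
suff : (1 - q ^+ n.+1) 0%N \is a GRing.unit by [].
by rewrite coef_fpsD coef_fpsN coef_fpsXn coef_fps1 subr0 unitr1.
Qed.

Lemma unit_1subQn n : 1 - Q ^+ n.+1 \is a GRing.unit.
Proof. by rewrite -exprM mulnS addSn unit_1subXn. Qed.

(** Adds [k ^ 2 = 1 + 3 + ... + (2k - 1)] to the weight of the partitions with
    [k] parts, that is, restores the staircase. *)
Definition twist (f : fps (fps int)) : fps (fps int) :=
  Fps (fun k => q ^+ (k ^ 2) * f k).

Lemma coef_twist f k : twist f k = q ^+ (k ^ 2) * f k.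
Proof. by []. Qed.

Fact twist_zmod : zmod_morphism twist.
Proof. by move=> f g; apply/fpsP => k /=; rewrite mulrBr. Qed.

HB.instance Definition _ :=
  GRing.isZmodMorphism.Build (fps (fps int)) (fps (fps int)) twist twist_zmod.

Lemma twistC c f : twist (fpsC c * f) = fpsC c * twist f.
Proof. by apply/fpsP => k; rewrite coef_fpsCM !coef_twist coef_fpsCM mulrCA. Qed.

Lemma twist_dilate c f : twist (dilate c f) = dilate c (twist f).
Proof. by apply/fpsP => k; rewrite coef_dilate !coef_twist coef_dilate mulrCA. Qed.

(** Since [(k + r) ^ 2 = r ^ 2 + 2 r k + k ^ 2], multiplication by [T ^ r] becomes
    an additional dilation. *)
Lemma twistX r f :
  twist (T ^+ r * f) = fpsC q ^+ (r ^ 2) * T ^+ r * D (2 * r) (twist f).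
Proof.
apply/fpsP => k; rewrite -rmorphXn -mulrA coef_fpsCM.
rewrite coef_twist !coef_fpsXnM coef_dilate.
case: leqP => rk; last by rewrite !mulr0.
rewrite coef_twist !mulrA -exprM -!exprD.
by congr (_ ^+ _ * _); nia.
Qed.

(** By Euler's identity, the product of [1 / (1 - t q ^ d)] over odd [d >= 3]. *)
Definition even_singles : fps (fps int) := Fps (fun i => q ^+ (3 * i) / qpoch Q Q i).

Lemma even_singlesE : even_singles = D 2 even_singles + fpsC q ^+ 3 * T * even_singles.
Proof.
apply/fpsP => i; rewrite coef_fpsD -rmorphXn -mulrA coef_fpsCM coef_fpsXM coef_dilate.
case: i => [|i]; first by rewrite mulr0 addr0 expr0 mul1r.
apply/eqP; rewrite addrC -subr_eq -{1}[even_singles _]mul1r -mulrBl.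
rewrite -[even_singles i.+1]/(q ^+ (3 * i.+1) / qpoch Q Q i.+1) mulrCA.
have := qpochV unit_1subQn 0 i; rewrite mul1n expr1 => ->.
by rewrite mulnS exprD -mulrA.
Qed.

(** By Euler's identity, the product of [1 / (1 - t ^ 2 q ^ (2 e))] over even
    [e >= 2]. *)
Definition doubles : fps (fps int) :=
  Fps (fun k => if odd k then 0 else q ^+ (4 * k./2) / qpoch (q ^+ 4) (q ^+ 4) k./2).

Lemma coef_doubles k : doubles k =
  if odd k then 0 else q ^+ (4 * k./2) / qpoch (q ^+ 4) (q ^+ 4) k./2.
Proof. by []. Qed.

Lemma doublesE : doubles = D 2 doubles + fpsC q ^+ 4 * T ^+ 2 * doubles.
Proof.
apply/fpsP => i; rewrite coef_fpsD -rmorphXn -mulrA coef_fpsCM coef_fpsXnM coef_dilate.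
case: i => [|[|i]]; first by rewrite mulr0 addr0 expr0 mul1r.
  by rewrite !mulr0 addr0.
rewrite !subSS subn0 !coef_doubles /= negbK.
case: ifP => [|/negbT i_even]; first by rewrite !mulr0 addr0.
apply/eqP; rewrite addrC -subr_eq -{1}[_ / _]mul1r -mulrBl mulrCA.
have -> : Q ^+ i.+2 = (q ^+ 4) ^+ (i./2).+1.
  by rewrite -!exprM -[in LHS](even_halfK i_even); congr (_ ^+ _); lia.
have := qpochV unit_1subXn 3 i./2; rewrite exprM => ->.
by rewrite exprS -exprM -mulrA.
Qed.

Definition base_series : fps (fps int) := total (stage Q false).

Definition kr_untwisted : fps (fps int) :=
  even_singles * doubles * D 2 base_series.

Lemma kr_untwisted_functional (V := kr_untwisted) :
  (1 - fpsC q ^+ 3 * T) * (1 - fpsC q ^+ 4 * T ^+ 2) * V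
  = (1 + fpsC q ^+ 4 * T + fpsC q ^+ 8 * T ^+ 2) * D 2 V.
Proof.
have A := stage_functional unit_1subQn; rewrite -/base_series expr1 in A.
have A2 : D 2 base_series
    = (1 + fpsC q ^+ 4 * T + fpsC q ^+ 8 * T ^+ 2) * D 2 (D 2 base_series).
  rewrite [in LHS]A !(rmorphM, rmorphD, rmorph1, rmorphXn) /= !(dilateX, dilateC).
  by rewrite !(rmorphXn (@fpsC _)) /=; congr (_ * _); ring.
have E3 : (1 - fpsC q ^+ 3 * T) * even_singles = D 2 even_singles.
  by rewrite mulrBl mul1r {1}even_singlesE addrK.
have E4 : (1 - fpsC q ^+ 4 * T ^+ 2) * doubles = D 2 doubles.
  by rewrite mulrBl mul1r {1}doublesE addrK.
rewrite /V /kr_untwisted !rmorphM /= -E3 -E4 [in LHS]A2.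
move: (D 2 (D 2 base_series)) => A4; ring.
Qed.

Definition kr_eqn (f : fps (fps int)) : Prop :=
  f - fpsC q ^+ 4 * T * D 2 f - fpsC q ^+ 8 * T ^+ 2 * D 4 f
    + fpsC q ^+ 16 * T ^+ 3 * D 6 f
  = D 2 f + fpsC q ^+ 5 * T * D 4 f + fpsC q ^+ 12 * T ^+ 2 * D 6 f.

Lemma kr_eqn_twist : kr_eqn (twist kr_untwisted).
Proof.
set V := kr_untwisted; set W := twist V.
have expand : (1 - fpsC q ^+ 3 * T) * (1 - fpsC q ^+ 4 * T ^+ 2) * V
    = V - fpsC (q ^+ 3) * (T ^+ 1 * V) - fpsC (q ^+ 4) * (T ^+ 2 * V)
      + fpsC (q ^+ 7) * (T ^+ 3 * V).
  rewrite !(rmorphXn (@fpsC (fps int))) /=; move: (fpsC q) T V {W} => z t v; ring.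
have expand' (V2 := D 2 V) : (1 + fpsC q ^+ 4 * T + fpsC q ^+ 8 * T ^+ 2) * V2
    = V2 + fpsC (q ^+ 4) * (T ^+ 1 * V2) + fpsC (q ^+ 8) * (T ^+ 2 * V2).
  rewrite !(rmorphXn (@fpsC (fps int))) /=; move: (fpsC q) T V2 {W} => z t v; ring.
have : (1 - fpsC q ^+ 3 * T) * (1 - fpsC q ^+ 4 * T ^+ 2) * V
    = (1 + fpsC q ^+ 4 * T + fpsC q ^+ 8 * T ^+ 2) * D 2 V.
  exact: kr_untwisted_functional.
rewrite expand expand' => /(congr1 twist).
rewrite !(raddfB, raddfD) /= !twistC !twistX !twist_dilate !dilate_dilate -/W -!exprD.
rewrite -[(2 * 1)%N]/2%N -[(2 * 2)%N]/4%N -[(2 * 3)%N]/6%N -[(2 + 2)%N]/4%N -[(4 + 2)%N]/6%N.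
have fpsCXn n : fpsC (q ^+ n) = fpsC q ^+ n by exact: rmorphXn.
rewrite !fpsCXn /kr_eqn; move: (D 2 W) (D 4 W) (D 6 W) (fpsC q) T => w2 w4 w6 z t E.
by apply: etrans (etrans _ E) _; ring.
Qed.

(** The coefficient of index [n + 1] is determined by the previous ones, because
    it is multiplied by the unit [1 - Q ^ (n + 1)]. *)
Lemma kr_eqn_unique f : kr_eqn f -> f 0%N = 0 -> f = 0.
Proof.
move=> fE f0; apply: vanish_eq0 => -[//|n] vf.
have rhs : f - D 2 f = T * (fpsC q ^+ 4 * D 2 f + fpsC q ^+ 8 * T * D 4 f
    - fpsC q ^+ 16 * T ^+ 2 * D 6 f + fpsC q ^+ 5 * D 4 f + fpsC q ^+ 12 * T * D 6 f).
  move: fE; rewrite /kr_eqn; move: (D 2 f) (D 4 f) (D 6 f) (fpsC q) T => f2 f4 f6 z t fE.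
  have -> : f = f2 + z ^+ 5 * t * f4 + z ^+ 12 * t ^+ 2 * f6
    + z ^+ 4 * t * f2 + z ^+ 8 * t ^+ 2 * f4 - z ^+ 16 * t ^+ 3 * f6.
    by rewrite -fE; ring.
  ring.
have : (f - D 2 f) n.+1 = 0.
  rewrite rhs; apply: (vanishXM (n := n.+1)) => //.
  rewrite -[- (_ * D 6 f)]mulNr -mulNr.
  by repeat first [assumption | apply: vanishD | apply: vanishM | apply: vanish_dilate].
rewrite coef_fpsD coef_fpsN coef_dilate -{1}[f n.+1]mul1r -mulrBl => /eqP.
rewrite mulrI_eq0 ?unit_1subQn // => [/eqP //|].
exact/mulrI/unit_1subQn.
Qed.

Lemma kr_series_twist : seq_series (kr_from 4) = twist kr_untwisted.
Proof.
set K := seq_series (kr_from 4); set W := twist kr_untwisted.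
apply/eqP; rewrite -subr_eq0; apply/eqP/kr_eqn_unique.
  have KE : kr_eqn K := kr_functional; have WE : kr_eqn W := kr_eqn_twist.
  move: KE WE; rewrite /kr_eqn !rmorphB /=.
  move: (D 2 W) (D 4 W) (D 6 W) (D 2 K) (D 4 K) (D 6 K) => w2 w4 w6 k2 k4 k6.
  move: K W (fpsC q) T => k w z t KE WE.
  have := congr2 (fun x y => x - y) KE WE => E.
  by apply: etrans (etrans _ E) _; ring.
rewrite coef_fpsD coef_fpsN coef_twist expr0 mul1r !coef0_fpsM.
have qpoch0 (x y : fps int) : qpoch x y 0 = 1 by rewrite /qpoch big_ord0.
have -> : even_singles 0%N = 1.
  by rewrite -[LHS]/(q ^+ (3 * 0) / qpoch Q Q 0) qpoch0 invr1 muln0 mulr1.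
have -> : doubles 0%N = 1.
  by rewrite coef_doubles /= qpoch0 invr1 muln0 mulr1.
have -> : (D 2 base_series) 0%N = 1.
  rewrite coef_dilate expr0 mul1r -[LHS]/(\sum_(N < 1) stage Q false N 0%N) big_ord1.
  rewrite /stage path_series0 coef_fpsCM coef_dilate expr0 mul1r qpoch0 invr1 mul1r.
  by rewrite -[LHS]/(Q ^+ (0 ^ 2) / qpoch Q Q 0) qpoch0 invr1 mulr1.
rewrite !mulr1; apply/eqP; rewrite subr_eq0; apply/eqP/fpsP => n.
by rewrite coef_fps1; case: n.
Qed.

End ProductSide.

(** * Expansion into the summands *)

Section Expansion.
Local Notation q := (fpsX int).
Local Notation Q := (fpsX int ^+ 2).
Local Notation T := (fpsX (fps int)).
Local Notation D n := (dilate (q ^+ n)%R).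
Local Notation type4 := (nat * nat * nat * nat)%type.
Local Notation index7 := (nat * nat * nat * nat * nat * nat * nat)%type.

Lemma doubles_expand n : eq_upto n doubles
  (\sum_(j <- iota 0 n) fpsC (q ^+ (4 * j) / qpoch (q ^+ 4) (q ^+ 4) j) * T ^+ (2 * j)).
Proof.
move=> k kn; rewrite coef_fps_sum coef_doubles.
case: ifP => [k_odd|/negbT k_even].
  rewrite big1 // => j _; rewrite coef_fpsCM coef_fpsXn.
  case: eqP => [kE|_]; last by rewrite mulr0.
  by rewrite kE mul2n odd_double in k_odd.
have kE : k = (2 * k./2)%N by rewrite mul2n even_halfK.
rewrite (@big_uniq1 _ _ _ k./2) ?iota_uniq ?mem_iota //; last 2 first.
- by lia.
- move=> i ik; rewrite coef_fpsCM coef_fpsXn; case: eqP => [kE'|]; rewrite ?mulr0 //.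
  by move: ik; rewrite kE' mul2n doubleK eqxx.
by rewrite coef_fpsCM coef_fpsXn -kE eqxx mulr1.
Qed.

Definition type_pairs (w : type4) : nat := let: (m1, m2, m3, _) := w in (m1 + m2 + 2 * m3)%N.
Definition type_size (w : type4) : nat :=
  let: (m1, m2, m3, _) := w in (2 * m1 + 2 * m2 + 5 * m3)%N.

(** The weight, for the inner variable, of the moveable singletons, together
    with the power of [q] coming from the number of parts and the denominators
    that depend on the pairs and the moveable singletons. *)
Definition weight (w : type4) (n : nat) : fps int :=
  let: (m1, m2, m3, m) := w in
  q ^+ (2 * m * n + 2 * n ^ 2 + 4 * m1 + 4 * m2 + 10 * m3 + 2 * n)
  / (qpoch Q Q n * qpoch (q ^+ 6) (q ^+ 6) (type_pairs w)).

Lemma path_typeE N G : G \in paths false 0 N ->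
  [/\ type_pairs (path_type G) = N, count is_pair G = N
    & type_size (path_type G) = size (flatten G)].
Proof.
move=> G_in; have [E1 E2] := paths_well_counted G_in.
have cnt := paths_size_pairs G_in.
by rewrite /path_type /= E2 -E1 -cnt -E1; split=> //; lia.
Qed.

Lemma dilate_term (R : comNzRingType) (x p : R) (a b l : nat) (f : fps R) :
  dilate x (fpsC p * (fpsC x ^+ a * fpsX R ^+ b * dilate (x ^+ l) f))
  = fpsC (p * x ^+ a * x ^+ b) * fpsX R ^+ b * dilate (x * x ^+ l) f.
Proof.
rewrite !(rmorphM, rmorphXn) /= !(dilateC, dilateX, dilate_dilate) exprMn.
rewrite !mulrA; congr (_ * _); rewrite -!mulrA; congr (_ * _).
Qed.

(** One path contributes, for each number of moveable singletons, the quantity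
    that the summand attaches to its type and its weight. *)
Lemma stage_term N G n : G \in paths false 0 N ->
  eq_upto n
   (D 2 (fpsC (qpoch (Q ^+ 3) (Q ^+ 3) N)^-1
     * (fpsC Q ^+ sumn (flatten G) * T ^+ size (flatten G)
        * dilate (Q ^+ last_pair 0 G) (singles Q))))
   (\sum_(k <- iota 0 n) fpsC (Q ^+ sumn (flatten G) * weight (path_type G) k)
      * T ^+ (type_size (path_type G) + k)).
Proof.
move=> G_in; have [wN _ wS] := path_typeE G_in.
have u1 i : qpoch Q Q i \is a GRing.unit := qpoch_unit unit_1subXn 1 i.
have u2 i : qpoch (q ^+ 6) (q ^+ 6) i \is a GRing.unit := qpoch_unit unit_1subXn 5 i.
have poch3 : qpoch (Q ^+ 3) (Q ^+ 3) N = qpoch (q ^+ 6) (q ^+ 6) N by rewrite -!exprM.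
rewrite dilate_term poch3.
apply: eq_upto_trans (eq_uptoM (@eq_upto_refl _ n _) (@eq_upto_expand _ n _)) _.
rewrite mulr_sumr; move=> k kn; congr (fps_coef _ k).
apply: eq_bigr => i _.
rewrite [LHS]mulrACA -exprD -rmorphM wS; congr (fpsC _ * _).
rewrite coef_dilate -[singles Q i]/(Q ^+ (i ^ 2) / qpoch Q Q i).
rewrite /path_type /weight in wN wS *; rewrite wN -wS.
rewrite (invrM (u1 i) (u2 N)).
move: (qpoch _ _ _)^-1 (qpoch _ _ _)^-1 => p1 p2.
rewrite /type_size -exprS -!exprM.
move: (last_pair 0 G) (free_of _ _) (free_of _ _) (blocks_of _) (sumn _) => l m1 m2 m3 a.
move: (fpsX int) => x.
have -> : x ^+ (2 * l * i + 2 * i ^ 2 + 4 * m2 + 4 * m1 + 10 * m3 + 2 * i)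
    = x ^+ (2 * (2 * m2 + 2 * m1 + 5 * m3)) * (x ^+ (2 * (l.+1 * i)) * x ^+ (2 * i ^ 2)).
  by rewrite -!exprD; congr (_ ^+ _); lia.
move: (x ^+ _) (x ^+ _) (x ^+ _) (x ^+ _) p1 p2 => x1 x2 x3 x4 p1 p2.
by ring.
Qed.

Definition paths_upto (B : nat) : seq (seq (seq nat)) :=
  flatten [seq paths false 0 N | N <- iota 0 B].

Definition path_term (G : seq (seq nat)) (n : nat) : fps (fps int) :=
  fpsC (Q ^+ sumn (flatten G) * weight (path_type G) n)
  * T ^+ (type_size (path_type G) + n).

Lemma base_series_paths B : eq_upto B (D 2 base_series)
  (\sum_(G <- paths_upto B) \sum_(n <- iota 0 B) path_term G n).
Proof.
apply: (eq_upto_trans (g := D 2 (\sum_(N < B) stage Q false N))).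
  apply/eq_uptoP; rewrite -rmorphB; apply/vanish_dilate/total_trunc => N.
  have [v _] := @vanish_stage _ Q (stage Q false) (stage Q true) unit_1subQn
    (stage_step unit_1subQn) N.
  exact: v.
rewrite rmorph_sum -(big_mkord xpredT (fun N => D 2 (stage Q false N))) /index_iota subn0.
rewrite big_flatten big_map.
apply: eq_upto_sum => N _ _.
rewrite /stage /path_series mulr_sumr rmorph_sum /=.
by apply: eq_upto_sum => G G_in _; apply: stage_term.
Qed.

Definition P_value (w : type4) : fps int :=
  let: (m1, m2, m3, m) := w in (map_poly intr (P m1 m2 m3 (m%:Z + 1))).[Q].

Lemma P_valueE w : P_value w =
  \sum_(G <- paths false 0 (type_pairs w) | path_type G == w) Q ^+ sumn (flatten G).
Proof.
case: w => [[[m1 m2] m3] m]; rewrite /P_value P_paths rmorph_sum horner_sum.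
by apply: eq_bigr => G _; rewrite /= map_polyXn hornerXn.
Qed.

Lemma mem_paths_upto B G : G \in paths_upto B ->
  G \in paths false 0 (type_pairs (path_type G)) /\ (type_pairs (path_type G) < B)%N.
Proof.
case/flattenP=> _ /mapP[N + ->]; rewrite mem_iota => NB G_in.
by have [-> _ _] := path_typeE G_in.
Qed.

Lemma type_pairs_size w : (type_pairs w <= type_size w)%N.
Proof. by case: w => [[[m1 m2] m3] m] /=; lia. Qed.

Lemma sum_paths_of_type B w (F : seq (seq nat) -> fps (fps int)) : (type_pairs w < B)%N ->
  \sum_(G <- paths_upto B | path_type G == w) F G =
  \sum_(G <- paths false 0 (type_pairs w) | path_type G == w) F G.
Proof.
move=> wB; rewrite big_flatten /= big_map.
rewrite (@big_uniq1 _ _ _ (type_pairs w)) ?iota_uniq ?mem_iota // => N Nw.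
rewrite big_seq_cond big1 // => G /andP[G_in /eqP Gw].
by have [E _ _] := path_typeE G_in; rewrite -E Gw eqxx in Nw.
Qed.

(** Types with at least [B] pairs do not occur in the list of paths, but their
    contribution is divisible by [T ^ B]. *)
Lemma P_term_paths B w n : eq_upto B
  (fpsC (P_value w * weight w n) * T ^+ (type_size w + n))
  (\sum_(G <- paths_upto B | path_type G == w) path_term G n).
Proof.
have [wB|Bw] := ltnP (type_pairs w) B.
  rewrite sum_paths_of_type // P_valueE mulr_suml rmorph_sum mulr_suml /= => k _.
  by congr (fps_coef _ k); apply: eq_bigr => G /eqP Gw; rewrite /path_term Gw.
move=> k kB; rewrite coef_fpsCM coef_fpsXn; case: eqP => [kE|_].
  by have := type_pairs_size w; lia.
rewrite mulr0 big_seq_cond big1 // => G /andP[/mem_paths_upto[_ lt_B] /eqP Gw].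
by rewrite Gw ltnNge Bw in lt_B.
Qed.

(** The smaller part of the last pair grows by at most 3 at each step, whence
    the larger range of the fourth component. *)
Definition type_box (B : nat) : seq type4 :=
  [seq (y, m) | y <- [seq (x, m3) | x <- [seq (m1, m2) | m1 <- iota 0 B, m2 <- iota 0 B],
                                    m3 <- iota 0 B],
                m <- iota 0 (3 * B)].

Lemma type_box_uniq B : uniq (type_box B).
Proof.
by do 3!(apply: allpairs_uniq; [|exact: iota_uniq|by move=> [? ?] [? ?] _ _ [-> ->]]);
  exact: iota_uniq.
Qed.

Lemma mem_pairs (S1 S2 : eqType) (s1 : seq S1) (s2 : seq S2) x y :
  ((x, y) \in [seq (a, b) | a <- s1, b <- s2]) = (x \in s1) && (y \in s2).
Proof.
apply/allpairsP/andP => [[[a b] [/= ? ? [-> ->]]] //|[xs ys]].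
by exists (x, y).
Qed.

Lemma mem_type_box B m1 m2 m3 m : ((m1, m2, m3, m) \in type_box B) =
  [&& m1 < B, m2 < B, m3 < B & m < 3 * B]%N.
Proof. by rewrite /type_box !mem_pairs !mem_iota /= !add0n -!andbA. Qed.

Lemma last_pair_le c a N G : G \in paths c a N -> (last_pair a G <= a + 3 * N)%N.
Proof.
elim: N c a G => [|N IH] c a G.
  by rewrite /= inE => /eqP ->; rewrite addn0.
case/pathsSP=> [st [G' [st_in /IH + ->]]]; rewrite (last_pair_step _ st_in).
by case: (stepsP st_in) => /=; lia.
Qed.

Lemma path_type_box B G : G \in paths_upto B -> path_type G \in type_box B.
Proof.
case/mem_paths_upto=> G_in; have := last_pair_le G_in.
by rewrite mem_type_box /path_type /=; lia.
Qed.

Lemma base_series_expand B : eq_upto B (D 2 base_series)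
  (\sum_(w <- type_box B) \sum_(n <- iota 0 B)
     fpsC (P_value w * weight w n) * T ^+ (type_size w + n)).
Proof.
apply: eq_upto_trans (@base_series_paths B) _.
apply: (eq_upto_trans (g := \sum_(w <- type_box B) \sum_(n <- iota 0 B)
    \sum_(G <- paths_upto B | path_type G == w) path_term G n)); last first.
  apply: eq_upto_sum => w _ _; apply: eq_upto_sum => n _ _ k kB.
  by rewrite (P_term_paths _ _ kB).
move=> k _; congr (fps_coef _ k).
have -> : \sum_(w <- type_box B) \sum_(n <- iota 0 B)
    \sum_(G <- paths_upto B | path_type G == w) path_term G n =
  \sum_(w <- type_box B) \sum_(G <- paths_upto B | path_type G == w)
    \sum_(n <- iota 0 B) path_term G n.
  by apply: eq_bigr => w _; rewrite exchange_big.
symmetry; rewrite (exchange_big_dep xpredT) //= big_seq [RHS]big_seq.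
apply: eq_bigr => G G_in; rewrite -big_filter.
have -> : [seq w <- type_box B | path_type G == w] = [:: path_type G].
  have := filter_pred1_uniq (type_box_uniq B) (path_type_box G_in).
  by move=> <-; apply: eq_filter => w /=; rewrite eq_sym.
by rewrite big_seq1.
Qed.

Definition double_coef (j : nat) : fps int := q ^+ (4 * j) / qpoch (q ^+ 4) (q ^+ 4) j.

Definition kr_term_size (x : index7) : nat :=
  let: (w, n, i, j) := x in (type_size w + n + i + 2 * j)%N.

Definition kr_term_coef (x : index7) : fps int :=
  let: (w, n, i, j) := x in P_value w * weight w n * even_singles i * double_coef j.

Definition kr_term (x : index7) : fps (fps int) := fpsC (kr_term_coef x) * T ^+ kr_term_size x.

Definition index_box (B : nat) : seq index7 :=
  [seq (y, j) | y <- [seq (z, i) | z <- [seq (w, n) | w <- type_box B, n <- iota 0 B],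
                                   i <- iota 0 B],
                j <- iota 0 B].

Lemma index_box_uniq B : uniq (index_box B).
Proof.
by do 3!(apply: allpairs_uniq; [|exact: iota_uniq|by move=> [? ?] [? ?] _ _ [-> ->]]);
  exact: type_box_uniq.
Qed.

Lemma kr_untwisted_expand B :
  eq_upto B kr_untwisted (\sum_(x <- index_box B) kr_term x).
Proof.
apply: (eq_upto_trans (eq_uptoM (eq_uptoM (@eq_upto_expand _ B _) (@doubles_expand B))
  (@base_series_expand B))).
move=> k _; congr (fps_coef _ k).
rewrite /index_box; move: (type_box B) => bx; rewrite !big_allpairs /= [LHS]mulrC mulr_suml.
apply: eq_bigr => w _.
rewrite mulr_suml; apply: eq_bigr => n _.
rewrite !mulr_suml mulr_sumr; apply: eq_bigr => i _.
rewrite !mulr_sumr; apply: eq_bigr => j _.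
rewrite /kr_term /kr_term_coef /kr_term_size -/(double_coef j) !(rmorphM (@fpsC _)) /=.
rewrite !exprD; move: (fpsC _) (fpsC _) (fpsC _) (fpsC _) => a b c d.
move: (T ^+ _) (T ^+ _) (T ^+ _) (T ^+ _) => x1 x2 x3 x4; ring.
Qed.

(** If the first three and the last three indices are within range, then [m]
    exceeds three times the number of pairs, and [P] vanishes. *)
Lemma kr_term_outside k x : x \notin index_box k.+1 -> kr_term x k = 0.
Proof.
rewrite /kr_term coef_fpsCM coef_fpsXn; case: eqP => [->|]; last by rewrite mulr0.
case: x => [[[w n] i] j] x_out; rewrite mulr1 /kr_term_coef.
suff -> : P_value w = 0 by rewrite !mul0r.
rewrite P_valueE big_seq_cond big1 // => G /andP[G_in /eqP Gw].
have := last_pair_le G_in.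
case: w Gw {G_in} x_out => [[[m1 m2] m3] m] [_ _ _ ->].
rewrite /index_box !mem_pairs ?mem_type_box !mem_iota /kr_term_size /=; lia.
Qed.

Lemma sum_kr_terms k s : uniq s -> {subset index_box k.+1 <= s} ->
  \sum_(x <- s) twist (kr_term x) k = seq_series (kr_from 4) k.
Proof.
move=> s_uniq sub; rewrite (big_superset (index_box_uniq k.+1)) //; last first.
  by move=> x /kr_term_outside tx; rewrite coef_twist tx mulr0.
rewrite kr_series_twist coef_twist (@kr_untwisted_expand k.+1) //.
by rewrite coef_fps_sum mulr_sumr.
Qed.

End Expansion.

(** * Positivity *)

Section Positivity.
Local Notation q := (fpsX int).

Definition nonneg (f : fps int) : Prop := forall n, 0 <= f n.

Lemma nonnegM f g : nonneg f -> nonneg g -> nonneg (f * g).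
Proof.
by move=> f0 g0 n; rewrite coef_fpsM; apply: sumr_ge0 => i _; apply: mulr_ge0.
Qed.

Lemma nonnegX n : nonneg (q ^+ n).
Proof. by move=> k; rewrite coef_fpsXn ler0n. Qed.

(** The inverse [g] satisfies [g = 1 + q ^ (n + 1) g]. *)
Lemma nonneg_geometric n : nonneg (1 - q ^+ n.+1)^-1.
Proof.
set g := (_)^-1 => k.
have gE : g = 1 + q ^+ n.+1 * g.
  have := divrr (unit_1subXn n); rewrite -/g mulrBl mul1r => <-.
  by rewrite subrK.
elim/ltn_ind: k => k IH; rewrite gE coef_fpsD coef_fps1 coef_fpsXnM.
case: ifP => nk; last by rewrite addr0 ler0n.
by rewrite addr_ge0 ?ler0n // IH // ltn_subrL /= (leq_trans _ nk).
Qed.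

Lemma nonneg_qpochV d n : nonneg (qpoch (q ^+ d.+1) (q ^+ d.+1) n)^-1.
Proof.
elim: n => [|n IH]; first by rewrite /qpoch big_ord0 invr1; apply: (nonnegX 0).
rewrite qpochS -exprS -exprM mulnS addSn invrM ?unit_1subXn //; last first.
  exact: qpoch_unit unit_1subXn _ _.
by apply: nonnegM => //; apply: nonneg_geometric.
Qed.

Lemma coef_P_ge0 m1 m2 m3 l n : 0 <= (P m1 m2 m3 l)`_n.
Proof.
rewrite /P; case: ifP => _; first by rewrite coefMn coef1; case: (_ == _); case: (_ == _).
by rewrite coef_sum sumr_ge0 // => b _; rewrite coefXn ler0n.
Qed.

Lemma nonneg_P_value w : nonneg (P_value w).
Proof.
move=> n; rewrite P_valueE coef_fps_sum sumr_ge0 // => G _.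
by rewrite -exprM nonnegX.
Qed.

Lemma nonneg_kr_term_coef x : nonneg (kr_term_coef x).
Proof.
case: x => [[[w n] i] j].
have pos (a d k : nat) : nonneg (q ^+ a / qpoch (q ^+ d.+1) (q ^+ d.+1) k).
  by apply: nonnegM; [exact: nonnegX | exact: nonneg_qpochV].
apply: nonnegM; last exact: pos.
apply: nonnegM; last exact: pos.
apply: nonnegM; first exact: nonneg_P_value.
case: w => [[[m1 m2] m3] m]; rewrite /weight.
rewrite invrM ?(qpoch_unit unit_1subXn) //.
by apply: nonnegM; [exact: nonnegX | apply: nonnegM; exact: nonneg_qpochV].
Qed.

End Positivity.

(** * The theorem *)

Section Summand.
Local Notation q := (fpsX int).
Local Notation Q := (fpsX int ^+ 2).
Local Notation T := (fpsX (fps int)).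

Lemma twist_kr_term x :
  twist (kr_term x) = fpsC (q ^+ (kr_term_size x ^ 2) * kr_term_coef x) * T ^+ kr_term_size x.
Proof.
apply/fpsP => k; rewrite coef_twist !coef_fpsCM coef_fpsXn.
by case: eqP => [->|]; rewrite ?mulr0 // !mulr1.
Qed.

Lemma summandE m1 m2 m3 m n12 i j :
  fpsC ((map_poly intr (P m1 m2 m3 (m%:Z + 1))).[q ^+ 2]
        / (qpoch (q ^+ 2) (q ^+ 2) n12
           * qpoch (q ^+ 6) (q ^+ 6) (m1 + m2 + 2 * m3)
           * qpoch (q ^+ 2) (q ^+ 2) i
           * qpoch (q ^+ 4) (q ^+ 4) j)
        * q ^+ (2 * m * n12 + 2 * n12 ^ 2 + 3 * i + 4 * j
                + 4 * m1 + 4 * m2 + 10 * m3 + 2 * n12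
                + (2 * m1 + 2 * m2 + 5 * m3 + n12 + i + 2 * j) ^ 2))
  * T ^+ (2 * m1 + 2 * m2 + 5 * m3 + n12 + i + 2 * j)
  = twist (kr_term (m1, m2, m3, m, n12, i, j)).
Proof.
have u d k : qpoch (q ^+ d.+1) (q ^+ d.+1) k \is a GRing.unit := qpoch_unit unit_1subXn d k.
have u2 := u 1%N; have u4 := u 3%N; have u6 := u 5%N.
rewrite twist_kr_term; congr (fpsC _ * _).
rewrite /kr_term_coef /weight -[even_singles i]/(q ^+ (3 * i) / qpoch Q Q i).
rewrite /double_coef -/(P_value (m1, m2, m3, m)) /type_pairs /kr_term_size /type_size.
have invM (a b c d : fps int) : a \is a GRing.unit -> b \is a GRing.unit ->
    c \is a GRing.unit -> d \is a GRing.unit ->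
    (a * b * c * d)^-1 = (a * b)^-1 * c^-1 * d^-1.
  by move=> ua ub uc ud; rewrite !invrM ?unitrM ?ua ?ub //; ring.
rewrite (invM _ _ _ _ (u2 _) (u6 _) (u2 _) (u4 _)).
move: (_^-1) (_^-1) (_^-1) (P_value _) => x1 x2 x3 p.
set M := ((2 * m1 + 2 * m2 + 5 * m3 + n12 + i + 2 * j) ^ 2)%N.
set e := (2 * m * n12 + 2 * n12 ^ 2 + 4 * m1 + 4 * m2 + 10 * m3 + 2 * n12)%N.
set e3 := (3 * i)%N; set e4 := (4 * j)%N.
have -> : (2 * m * n12 + 2 * n12 ^ 2 + e3 + e4 + 4 * m1 + 4 * m2 + 10 * m3 + 2 * n12 + M
    = M + e + e3 + e4)%N by rewrite /e; lia.
rewrite !exprD; move: (q ^+ M) (q ^+ e) (q ^+ e3) (q ^+ e4) => y1 y2 y3 y4.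
ring.
Qed.

End Summand.

Theorem theorem18 :
  let q : fps int := fpsX int in
  let t : fps (fps int) := fpsX (fps int) in
  let summand (m1 m2 m3 m n12 i j : nat) : fps (fps int) :=
    fpsC ((map_poly intr (P m1 m2 m3 (m%:Z + 1))).[q ^+ 2]
          / (qpoch (q ^+ 2) (q ^+ 2) n12
             * qpoch (q ^+ 6) (q ^+ 6) (m1 + m2 + 2 * m3)
             * qpoch (q ^+ 2) (q ^+ 2) i
             * qpoch (q ^+ 4) (q ^+ 4) j)
          * q ^+ (2 * m * n12 + 2 * n12 ^ 2 + 3 * i + 4 * j
                  + 4 * m1 + 4 * m2 + 10 * m3 + 2 * n12
                  + (2 * m1 + 2 * m2 + 5 * m3 + n12 + i + 2 * j) ^ 2))
    * t ^+ (2 * m1 + 2 * m2 + 5 * m3 + n12 + i + 2 * j) in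
  [/\ fps2_sum
        (fun x : nat * nat * nat * nat * nat * nat * nat =>
           let: (m1, m2, m3, m, n12, i, j) := x in
           summand m1 m2 m3 m n12 i j)
        (Fps (fun m => Fps (fun n => (kr3 n m)%:Z))),
      forall (m1 m2 m3 : nat) (l : int) (n : nat), 0 <= (P m1 m2 m3 l)`_n
    & forall m1 m2 m3 m n12 i j k n : nat,
        0 <= summand m1 m2 m3 m n12 i j k n].
Proof.
move=> q t summand; split; last 2 first.
- exact: coef_P_ge0.
- move=> m1 m2 m3 m n12 i j k n; rewrite /summand summandE twist_kr_term coef_fpsCM coef_fpsXn.
  case: eqP => _; last by rewrite mulr0.
  by rewrite mulr1; apply: nonnegM; [exact: nonnegX | exact: nonneg_kr_term_coef].
move=> k n; exists (index_box k.+1) => s s_uniq sub.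
rewrite -[RHS]/(Posz (kr3 n k)) kr3_series -(sum_kr_terms s_uniq sub) coef_fps_sum.
by apply: eq_bigr => -[[[[[[m1 m2] m3] m] n12] i] j] _; rewrite /summand summandE.
Qed.
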